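(* Let $w\in S_n$ be $1432$-avoiding. Then $$\mathfrak{G}_w=\sum_{E\in\mathsf{KKoh}(w)}(-1)^{|\mathrm{wt}(E)|-\ell(w)}x^{\mathrm{wt}(E)},$$ in other words $\#\mathsf{KKoh}(w,\alpha)=\#\mathrm{PD}(w,\alpha)$ for every $\alpha\in\mathbb{Z}_{\geq 0}^n$; and moreover $\#\mathsf{GKKoh}(w,\alpha)=\#\mathrm{PD}(w,\alpha)$ for every $\alpha\in\mathbb{Z}_{\geq 0}^n$.
   Context: A permutation $w$ is $1432$-avoiding if there are no indices $j_1<j_2<j_3<j_4$ with $w(j_1)<w(j_4)<w(j_3)<w(j_2)$. $\ell(w)$ is the Coxeter length (number of inversions). For a vector $\alpha$, $|\alpha|$ is the sum of its entries and $x^\alpha=\prod x_i^{\alpha_i}$. Cells of $[n]\times[n]$ are indexed in matrix notation: $(i,j)$ is row $i$ (from the top), column $j$ (from the left). Grothendieck polynomials. On $\mathbb{Z}[x_1,\dots,x_n]$ set $\partial_j(f)=\frac{f-s_j\cdot f}{x_j-x_{j+1}}$ ($s_j$ swaps $x_j,x_{j+1}$) and $\overline{\partial}_j(f)=\partial_j((1-x_{j+1})f)$. Then $\mathfrak{G}_{w_0}=x_1^{n-1}x_2^{n-2}\cdots x_{n-1}$ for $w_0=n(n-1)\cdots1$, and $\mathfrak{G}_w=\overline{\partial}_j\mathfrak{G}_{ws_j}$ if $w(j)<w(j+1)$. Pipe dreams. A pipe dream is a filling of $\{(i,j)\in[n]\times[n]: i+j\leq n\}$ with crossing tiles (a pipe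 entering from the top exits at the bottom, from the right exits at the left) and bump tiles (a pipe entering from the top exits at the left, from the right exits at the bottom); half-bump tiles (a pipe entering from the top exits at the left) are placed on $i+j=n+1$. Label the $n$ pipes $1,\dots,n$ along the top edge from left to right and trace them downwards and leftwards, ignoring any crossing between two pipes that have already crossed (treat such crossing tiles as bump tiles); the permutation $w$ of the pipe dream is obtained by reading labels along the left edge from top to bottom as $w(1)\cdots w(n)$. (Equivalently, $w$ is the Demazure (0-Hecke) product of the $s_{i+j-1}$ over the crossing tiles $(i,j)$, read row by row from top to bottom and right to left within each row.) $\mathrm{PD}(w)$ is the set of pipe dreams with permutation $w$; $\mathrm{wt}(P)_i$ is the number of crossing tiles in row $i$; $\mathrm{PD}(w,\alpha)=\{P\in\mathrm{PD}(w):\mathrm{wt}(P)=\alpha\}$. Grave diagrams and moves. $D(w)=\{(i,j)\in[n]^2: i<w^{-1}(j),\ j<w(i)\}$. A grave diagram is a pair $E=(B,G)$ of disjoint subsets of $[n]\times[n]$; cells of $B$ are boxes, cells of $G$ are ghosts, cells of $B\cup G$ are occupied; $\mathrm{wt}(E)_i=\#\{j:(i,j)\in B\cup G\}$. (a) Suppose $(i,j)\in B$ is rightmost among all occupied cells in row $i$; let $i'=\max\{r: 1\leq r<i,\ (r,j)\notin B\cup G\}$; assume $i'$ exists and every occupied cell $(r,j)$ with $i'<r\leq i$ is a box. The ordinary Kohnert move is $(B,G)\mapsto((B\setminus\{(i,j)\})\cup\{(i',j)\},G)$; the $K$-Kohnert move is $(B,G)\mapsto((B\setminus\{(i,j)\})\cup\{(i',j)\},G\cup\{(i,j)\})$.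 (b) Suppose $(i,j)\in G$ is the rightmost occupied cell in row $i$; let $i'=\max\{r: 1\leq r<i,\ (r,j)\notin B\cup G\}$; assume $i'$ exists and every occupied cell $(r,j)$ with $i'<r<i$ is a ghost. The ghost Kohnert move is $(B,G)\mapsto(B,(G\setminus\{(i,j)\})\cup\{(i',j)\})$; the ghost $K$-Kohnert move is $(B,G)\mapsto(B,G\cup\{(i',j)\})$. $\mathsf{KKoh}(w)$ is the closure of $(D(w),\varnothing)$ under the moves (a); $\mathsf{GKKoh}(w)$ is the closure of $(D(w),\varnothing)$ under all four moves (a),(b). $\mathsf{KKoh}(w,\alpha)$ and $\mathsf{GKKoh}(w,\alpha)$ are the subsets of diagrams of weight $\alpha$. *)

(* Defs.v *)
From mathcomp Require Import all_boot all_order all_algebra all_fingroup.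
From mathcomp Require Import fraction zify ring.
From mathcomp Require Import mpoly.

Set Implicit Arguments.
Unset Strict Implicit.
Unset Printing Implicit Defensive.

Import GRing.Theory.

Local Open Scope nat_scope.
Local Open Scope ring_scope.

(* Rows, columns, pipe labels and values of permutations all lie in 'I_n, so  *)
(* everything is shifted by one: the integer k of [n] = {1, ..., n} is the    *)
(* ordinal k - 1, and a cell (i, j) (row i, column j) is a pair of ordinals.  *)

Section Permutations.
Variable n : nat.
Implicit Types w : 'S_n.

Definition avoids1432 w : Prop :=
  ~ exists j1 j2 j3 j4 : 'I_n,
      [/\ (j1 < j2)%N, (j2 < j3)%N & (j3 < j4)%N]
      /\ [/\ (w j1 < w j4)%N, (w j4 < w j3)%N & (w j3 < w j2)%N].

Definition coxeter_length w : nat :=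
  #|[set p : 'I_n * 'I_n | (p.1 < p.2)%N && (w p.2 < w p.1)%N]|.

Definition longest_perm : 'S_n := perm (@rev_ord_inj n).

End Permutations.

Section DividedDifference.
Variable n : nat.
Implicit Types (i j k : 'I_n) (f g : {mpoly int[n]}).

Definition is_ddiff i k f g : bool :=
  g * ('X_i - 'X_k) == f - msym (tperm i k) f.

Lemma msym_tpermX i k l :
  msym (tperm i k) 'X_l = 'X_(tperm i k l) :> {mpoly int[n]}.
Proof.
rewrite msymX; congr ('X_[_]); apply/mnmP => t.
by rewrite mnmE tpermV !mnm1E -(inj_eq (@perm_inj _ (tperm i k))) tpermK.
Qed.

Lemma ddiff_exists i k f : exists g, is_ddiff i k f g.
Proof.
have HM p q : (exists g, is_ddiff i k p g) -> (exists g, is_ddiff i k q g) ->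
    exists g, is_ddiff i k (p * q) g.
  move=> [g /eqP Hg] [h /eqP Hh].
  exists (g * q + msym (tperm i k) p * h); apply/eqP.
  transitivity (g * ('X_i - 'X_k) * q
                + msym (tperm i k) p * (h * ('X_i - 'X_k))); first by ring.
  by rewrite Hg Hh msymM; ring.
have H1 : exists g, is_ddiff i k 1 g.
  by exists 0; rewrite /is_ddiff msym1 mul0r subrr.
have HX l : exists g, is_ddiff i k 'X_l g.
  rewrite /is_ddiff msym_tpermX; case: tpermP => [->|->|_ _].
  - by exists 1; rewrite mul1r.
  - by exists (-1); rewrite mulN1r opprB.
  - by exists 0; rewrite subrr mul0r.
elim/mpolyind: f => [|c m p _ _ [h /eqP Hh]].
  by exists 0; rewrite /is_ddiff msym0 mul0r subrr.
have [g /eqP Hg] : exists g, is_ddiff i k 'X_[m] g.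
  rewrite mpolyXE_id; apply: (big_ind (fun p => exists g, is_ddiff i k p g)) => // l _.
  elim: (m l) => [|e IH]; first by rewrite expr0.
  by rewrite exprS; apply: HM.
exists (c *: g + h); apply/eqP.
by rewrite msymD msymZ mulrDl -scalerAl Hg Hh scalerBr; ring.
Qed.

(* For i != k, the unique polynomial g with                                   *)
(*   g * (x_i - x_k) = f - (f with x_i and x_k exchanged).                    *)
Definition ddiff i k f : {mpoly int[n]} := xchoose (ddiff_exists i k f).

Lemma ddiffE i k f : ddiff i k f * ('X_i - 'X_k) = f - msym (tperm i k) f.
Proof. exact/eqP/(xchooseP (ddiff_exists i k f)). Qed.

Definition isobaric_ddiff i k f : {mpoly int[n]} := ddiff i k ((1 - 'X_k) * f).

Local Notation dd := isobaric_ddiff.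
Local Notation X := (fun l => 'X_l : {mpoly int[n]}).

Lemma isobaric_ddiffE i k f :
  dd i k f * ('X_i - 'X_k)
  = (1 - 'X_k) * f - (1 - 'X_i) * msym (tperm i k) f.
Proof. by rewrite ddiffE msymM msymB msym1 msym_tpermX tpermR. Qed.

Lemma subX_neq0 i k : i != k -> X i - X k != 0.
Proof.
move=> nik; rewrite subr_eq0; apply: contra nik => /eqP/(congr1 (mcoeff U_(i))).
rewrite !mcoeffXU eqxx eq_sym; by case: eqP.
Qed.

Lemma ddiff_unique i k f g : i != k -> is_ddiff i k f g -> g = ddiff i k f.
Proof.
by move=> nik /eqP; rewrite -ddiffE => /(mulIf (subX_neq0 nik)).
Qed.

Lemma msym_isobaric_ddiff (s : 'S_n) i k f :
  (forall l, msym s (X l) = X (s l)) ->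
  msym s (dd i k f) * ('X_(s i) - 'X_(s k))
  = (1 - 'X_(s k)) * msym s f
    - (1 - 'X_(s i)) * msym s (msym (tperm i k) f).
Proof.
move=> Hs; rewrite -!Hs -msymB -msymM isobaric_ddiffE.
by rewrite !(msymB, msymM, msym1).
Qed.

Lemma comm_idomain (R : idomainType)
  (x y u v f f1 f2 f12 g g1 h h2 d d' : R) :
  x - y != 0 -> u - v != 0 ->
  d * (x - y) = (1 - y) * g - (1 - x) * g1 ->
  g * (u - v) = (1 - v) * f - (1 - u) * f2 ->
  g1 * (u - v) = (1 - v) * f1 - (1 - u) * f12 ->
  d' * (u - v) = (1 - v) * h - (1 - u) * h2 ->
  h * (x - y) = (1 - y) * f - (1 - x) * f1 ->
  h2 * (x - y) = (1 - y) * f2 - (1 - x) * f12 ->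
  d = d'.
Proof.
move=> nxy nuv Ed Eg Eg1 Ed' Eh Eh2.
apply: (mulIf nxy); apply: (mulIf nuv); rewrite Ed.
transitivity ((1 - y) * (g * (u - v)) - (1 - x) * (g1 * (u - v))); first by ring.
rewrite Eg Eg1 mulrAC Ed'.
transitivity ((1 - v) * (h * (x - y)) - (1 - u) * (h2 * (x - y))); last by ring.
by rewrite Eh Eh2; ring.
Qed.

Lemma isobaric_ddiffC i k i' k' f :
    i != k -> i' != k' -> i != i' -> i != k' -> k != i' -> k != k' ->
  dd i k (dd i' k' f) = dd i' k' (dd i k f).
Proof.
move=> nik nik' n1 n2 n3 n4.
have E1 := isobaric_ddiffE i k f.
have E2 := isobaric_ddiffE i' k' f.
have E3 := msym_isobaric_ddiff i' k' f (msym_tpermX i k).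
have E4 := msym_isobaric_ddiff i k f (msym_tpermX i' k').
have [m1 m2 m3 m4] : [/\ i' != i, k' != i, i' != k & k' != k].
  by split; rewrite eq_sym.
rewrite (tpermD n1 n3) (tpermD n2 n4) in E3.
rewrite (tpermD m1 m2) (tpermD m3 m4) in E4.
have C : msym (tperm i k) (msym (tperm i' k') f)
       = msym (tperm i' k') (msym (tperm i k) f).
  have P : (tperm i' k' * tperm i k = tperm i k * tperm i' k')%g.
    by rewrite (conjgC (tperm i' k')) tpermJ (tpermD n1 n3) (tpermD n2 n4).
  by rewrite -[LHS]msymMm -[RHS]msymMm P.
rewrite C in E3.
exact: (comm_idomain (subX_neq0 nik) (subX_neq0 nik')
  (isobaric_ddiffE i k _) E2 E3 (isobaric_ddiffE i' k' _) E1 E4).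
Qed.

End DividedDifference.

Lemma braid_field (F : fieldType)
  (x y z f f1 f2 f12 f21 f121 g g1 g2 g12 h h1 k g' g'1 g'2 g'21 h' h'2 k' : F) :
  x - y != 0 -> y - z != 0 -> x - z != 0 ->
  g * (x - y) = (1 - y) * f - (1 - x) * f1 ->
  g2 * (x - z) = (1 - z) * f2 - (1 - x) * f21 ->
  g1 * (y - x) = (1 - x) * f1 - (1 - y) * f ->
  g12 * (y - z) = (1 - z) * f12 - (1 - y) * f121 ->
  h * (y - z) = (1 - z) * g - (1 - y) * g2 ->
  h1 * (x - z) = (1 - z) * g1 - (1 - x) * g12 ->
  k * (x - y) = (1 - y) * h - (1 - x) * h1 ->
  g' * (y - z) = (1 - z) * f - (1 - y) * f2 ->
  g'1 * (x - z) = (1 - z) * f1 - (1 - x) * f12 ->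
  g'2 * (z - y) = (1 - y) * f2 - (1 - z) * f ->
  g'21 * (x - y) = (1 - y) * f21 - (1 - x) * f121 ->
  h' * (x - y) = (1 - y) * g' - (1 - x) * g'1 ->
  h'2 * (x - z) = (1 - z) * g'2 - (1 - x) * g'21 ->
  k' * (y - z) = (1 - z) * h' - (1 - y) * h'2 ->
  k = k'.
Proof.
move=> nxy nyz nxz.
have nyx : y - x != 0 by rewrite -opprB oppr_eq0.
have nzy : z - y != 0 by rewrite -opprB oppr_eq0.
have D (a b c : F) : b != 0 -> a * b = c -> a = c / b by move=> nb <-; rewrite mulfK.
do 14 (move/D => /(_ ltac:(done)) ->).
by field; rewrite nxy nyz nxz nyx nzy.
Qed.

Lemma braid_idomain (R : idomainType)
  (x y z f f1 f2 f12 f21 f121 g g1 g2 g12 h h1 k g' g'1 g'2 g'21 h' h'2 k' : R) :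
  x - y != 0 -> y - z != 0 -> x - z != 0 ->
  g * (x - y) = (1 - y) * f - (1 - x) * f1 ->
  g2 * (x - z) = (1 - z) * f2 - (1 - x) * f21 ->
  g1 * (y - x) = (1 - x) * f1 - (1 - y) * f ->
  g12 * (y - z) = (1 - z) * f12 - (1 - y) * f121 ->
  h * (y - z) = (1 - z) * g - (1 - y) * g2 ->
  h1 * (x - z) = (1 - z) * g1 - (1 - x) * g12 ->
  k * (x - y) = (1 - y) * h - (1 - x) * h1 ->
  g' * (y - z) = (1 - z) * f - (1 - y) * f2 ->
  g'1 * (x - z) = (1 - z) * f1 - (1 - x) * f12 ->
  g'2 * (z - y) = (1 - y) * f2 - (1 - z) * f ->
  g'21 * (x - y) = (1 - y) * f21 - (1 - x) * f121 ->
  h' * (x - y) = (1 - y) * g' - (1 - x) * g'1 ->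
  h'2 * (x - z) = (1 - z) * g'2 - (1 - x) * g'21 ->
  k' * (y - z) = (1 - z) * h' - (1 - y) * h'2 ->
  k = k'.
Proof.
pose t : {rmorphism R -> {fraction R}} := @tofrac R.
have T (a b c d e u v : R) : a * (b - c) = (1 - d) * e - (1 - u) * v ->
    t a * (t b - t c) = (1 - t d) * t e - (1 - t u) * t v.
  by move/(congr1 t); rewrite !(rmorphB, rmorphM, rmorph1).
have N (a b : R) : a - b != 0 -> t a - t b != 0 by rewrite -rmorphB /= tofrac_eq0.
move=> /N nxy /N nyz /N nxz.
do 14 move=> /T ?.
apply/eqP; rewrite -tofrac_eq; apply/eqP.
by apply: (@braid_field _ (t x) (t y) (t z)
  (t f) (t f1) (t f2) (t f12) (t f21) (t f121)
  (t g) (t g1) (t g2) (t g12) (t h) (t h1) (t k)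
  (t g') (t g'1) (t g'2) (t g'21) (t h') (t h'2) (t k')).
Qed.

Lemma isobaric_ddiff_braid n (a b c : 'I_n) f :
    a != b -> b != c -> a != c ->
  isobaric_ddiff a b (isobaric_ddiff b c (isobaric_ddiff a b f))
  = isobaric_ddiff b c (isobaric_ddiff a b (isobaric_ddiff b c f)).
Proof.
move=> nab nbc nac.
have [nba nca ncb] : [/\ b != a, c != a & c != b] by split; rewrite eq_sym.
set dab := isobaric_ddiff a b; set dbc := isobaric_ddiff b c.
pose s1 := msym (R := int) (tperm a b); pose s2 := msym (R := int) (tperm b c).
have ab1 := msym_tpermX a b; have bc1 := msym_tpermX b c.
have ab2 l : msym (tperm b c * tperm a b)%g 'X_l
    = 'X_((tperm b c * tperm a b)%g l) :> {mpoly int[n]}.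
  by rewrite msymMm bc1 ab1 permM.
have bc2 l : msym (tperm a b * tperm b c)%g 'X_l
    = 'X_((tperm a b * tperm b c)%g l) :> {mpoly int[n]}.
  by rewrite msymMm ab1 bc1 permM.
have br : s2 (s1 (s2 f)) = s1 (s2 (s1 f)).
  have Jab : (tperm a b ^ tperm b c = tperm a c)%g.
    by rewrite tpermJ tpermL tpermD // eq_sym.
  have Jbc : (tperm b c ^ tperm a b = tperm a c)%g.
    by rewrite tpermJ tpermR tpermD // eq_sym.
  have P : (tperm b c * tperm a b * tperm b c
            = tperm a b * tperm b c * tperm a b)%g.
    by move: Jab Jbc; rewrite !conjgE !tpermV !mulgA => -> ->.
  by have := congr1 (fun s => msym s f) P; rewrite !msymMm.
have E1 g := isobaric_ddiffE a b g; have E2 g := isobaric_ddiffE b c g.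
have F12 g := msym_isobaric_ddiff b c g ab1.
have F21 g := msym_isobaric_ddiff a b g bc1.
have F11 g := msym_isobaric_ddiff a b g ab1.
have F22 g := msym_isobaric_ddiff b c g bc1.
have F121 g := msym_isobaric_ddiff a b g ab2.
have F212 g := msym_isobaric_ddiff b c g bc2.
have tc : tperm a b c = c by rewrite tpermD // eq_sym.
have ta : tperm b c a = a by rewrite tpermD // eq_sym.
rewrite ?permM !(tpermL, tpermR, tc, ta) in F12 F21 F11 F22 F121 F212.
have nX (i k : 'I_n) := @subX_neq0 n i k.
have P1 := F11 f; rewrite -msymMm tperm2 msym1m in P1.
have P2 := F22 f; rewrite -msymMm tperm2 msym1m in P2.
have P12 := F121 f; rewrite !msymMm in P12.
have P21 := F212 f; rewrite !msymMm in P21.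
rewrite -/s1 -/s2 br in P21.
exact: (braid_idomain (nX _ _ nab) (nX _ _ nbc) (nX _ _ nac)
  (E1 f) (F21 f) P1 P12 (E2 (dab f)) (F12 (dab f)) (E1 (dbc (dab f)))
  (E2 f) (F12 f) P2 P21 (E1 (dbc f)) (F21 (dbc f)) (E2 (dab (dbc f)))).
Qed.

Definition is_ascent n (w : 'S_n) (i k : 'I_n) : bool :=
  (k == i.+1 :> nat) && (w i < w k)%N.

Section AscentRecursion.
Variables (n : nat) (T : Type) (base : T) (dd : 'I_n -> 'I_n -> T -> T).
Hypothesis ddC : forall i k i' k' f,
  i != k -> i' != k' -> i != i' -> i != k' -> k != i' -> k != k' ->
  dd i k (dd i' k' f) = dd i' k' (dd i k f).
Hypothesis dd_braid : forall a b c f, a != b -> b != c -> a != c ->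
  dd a b (dd b c (dd a b f)) = dd b c (dd a b (dd b c f)).
Implicit Types (w : 'S_n) (i k : 'I_n).

Let mu w : nat := (\sum_(i < n) i * w i)%N.

Let mu_lt w i k : is_ascent w i k -> (mu (tperm i k * w)%g < mu w)%N.
Proof.
move=> /andP[/eqP ki wik]; have nki : k != i by apply/eqP => e; rewrite e in ki; lia.
rewrite /mu (bigD1 i) //= (bigD1 k) //= [X in (_ < X)%N](bigD1 i) //=.
rewrite [X in (_ < _ + X)%N](bigD1 k) //= !permM tpermL tpermR.
rewrite [X in (_ + (_ + X) < _)%N](eq_bigr (fun j : 'I_n => (j * w j)%N)).
  by move: (bigop _ _ _) => S; rewrite ki; nia.
by move=> j /andP[nji njk]; rewrite permM tpermD // eq_sym.
Qed.

Fixpoint grec m w : T :=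
  if m is m'.+1 then
    if [pick p : 'I_n * 'I_n | is_ascent w p.1 p.2] is Some p
    then dd p.1 p.2 (grec m' (tperm p.1 p.2 * w)%g) else base
  else base.

Let grec_stable m m' w : (mu w < m)%N -> (mu w < m')%N -> grec m w = grec m' w.
Proof.
elim: m m' w => [|m IH] [|m'] w //= lt1 lt2; case: pickP => //= p /mu_lt asc.
by congr (dd _ _ _); apply: IH; lia.
Qed.

Let G w := grec (mu w).+1 w.

Let G_asc w i k : is_ascent w i k -> G w = dd i k (G (tperm i k * w)%g).
Proof.
have [m] := ubnP (mu w); elim: m w i k => // m IH w i k; rewrite ltnS => lem ascik.
have [p ascp ->] : exists2 p, is_ascent w p.1 p.2
    & G w = dd p.1 p.2 (G (tperm p.1 p.2 * w)%g).
  rewrite {1}/G /=; case: pickP => [p ascp|/(_ (i, k))]; last by rewrite /= ascik.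
  by exists p => //; congr (dd _ _ _); apply: grec_stable; first exact: mu_lt.
have adj a b c : is_ascent w a b -> is_ascent w b c ->
    dd a b (G (tperm a b * w)%g) = dd b c (G (tperm b c * w)%g).
  move=> ab bc; have /andP[/eqP eb wab] := ab; have /andP[/eqP ec wbc] := bc.
  have nab : a != b by apply/eqP => e; rewrite e in eb; lia.
  have nbc : b != c by apply/eqP => e; rewrite e in ec; lia.
  have nac : a != c by apply/eqP => e; rewrite e in eb; lia.
  have [nba ncb nca] : [/\ b != a, c != b & c != a] by split; rewrite eq_sym.
  have wac := ltn_trans wab wbc.
  have lab := leq_trans (mu_lt ab) lem; have lbc := leq_trans (mu_lt bc) lem.
  have tc : tperm a b c = c by rewrite tpermD.
  have ta : tperm b c a = a by rewrite tpermD.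
  have A1 : is_ascent (tperm a b * w)%g b c.
    by rewrite /is_ascent !permM tpermR tc ec eqxx.
  have A2 : is_ascent (tperm b c * (tperm a b * w))%g a b.
    by rewrite /is_ascent !permM ta !tpermL tc eb eqxx.
  have B1 : is_ascent (tperm b c * w)%g a b.
    by rewrite /is_ascent !permM tpermL ta eb eqxx.
  have B2 : is_ascent (tperm a b * (tperm b c * w))%g b c.
    by rewrite /is_ascent !permM tc !tpermR ta ec eqxx.
  have lA := ltn_trans (mu_lt A1) lab; have lB := ltn_trans (mu_lt B1) lbc.
  rewrite (IH _ _ _ lab A1) (IH _ _ _ lA A2) (IH _ _ _ lbc B1) (IH _ _ _ lB B2).
  rewrite dd_braid //; congr (dd _ _ (dd _ _ (dd _ _ (G _)))).
  have Jab : (tperm a b ^ tperm b c = tperm a c)%g by rewrite tpermJ tpermL ta.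
  have Jbc : (tperm b c ^ tperm a b = tperm a c)%g by rewrite tpermJ tpermR tc.
  by move: Jab Jbc; rewrite !conjgE !tpermV !mulgA => -> ->.
case: p ascp => a b /= ascab.
have /andP[/eqP eb wab] := ascab; have /andP[/eqP ek wik] := ascik.
have [eai|nai] := eqVneq a i.
  have ebk : b = k by apply/val_inj; rewrite /= eb ek eai.
  by rewrite eai ebk.
have [ebi|nbi] := eqVneq b i; first by subst b; exact: adj.
have [eka|nka] := eqVneq k a; first by subst k; apply/esym/adj.
have nbk : b != k.
  by apply: contra nai => /eqP e; apply/eqP/val_inj; move: eb; rewrite e ek => -[].
have nab : a != b by apply/eqP => e; rewrite e in eb; lia.
have nik : i != k by apply/eqP => e; rewrite e in ek; lia.
have nak : a != k by rewrite eq_sym.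
have [nia nib nkb] : [/\ i != a, i != b & k != b] by split; rewrite eq_sym.
have A : is_ascent (tperm a b * w)%g i k.
  by rewrite /is_ascent !permM !tpermD // ek eqxx.
have B : is_ascent (tperm i k * w)%g a b.
  by rewrite /is_ascent !permM !tpermD // eb eqxx.
have lA := leq_trans (mu_lt ascab) lem; have lB := leq_trans (mu_lt ascik) lem.
rewrite (IH _ _ _ lA A) (IH _ _ _ lB B).
rewrite ddC //.
congr (dd _ _ (dd _ _ (G _))).
by rewrite !mulgA (conjgC (tperm i k)) tpermJ !tpermD.
Qed.

Lemma ascent_recursion : exists G : 'S_n -> T,
  G (longest_perm n) = base /\
  forall w i k, is_ascent w i k -> G w = dd i k (G (tperm i k * w)%g).
Proof.
exists G; split=> [|w i k]; last exact: G_asc.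
rewrite /G /=; case: pickP => // -[i k] /= /andP[/eqP ek].
by rewrite !permE /= ek; lia.
Qed.

End AscentRecursion.

Section Grothendieck.
Variable n : nat.
Implicit Types (w : 'S_n) (i k : 'I_n) (p : 'I_n * 'I_n).

Definition staircase_monomial : {mpoly int[n]} :=
  'X_[[multinom (n - i.+1)%N | i < n]].

(* (s * t)%g is "first s, then t" on permutations, so tperm i k * w is the    *)
(* permutation w s_i with the values in positions i and k = i + 1 exchanged.  *)
Definition is_grothendieck_family (G : {ffun 'S_n -> {mpoly int[n]}}) : bool :=
  (G (longest_perm n) == staircase_monomial) &&
  [forall w, forall i, forall k, is_ascent w i k ==>
     (G w == isobaric_ddiff i k (G (tperm i k * w)%g))].

Lemma grothendieck_family_exists : exists G, is_grothendieck_family G.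
Proof.
have [G [G0 G1]] :=
  ascent_recursion staircase_monomial (@isobaric_ddiffC n) (@isobaric_ddiff_braid n).
exists [ffun w => G w]; apply/andP; split; first by rewrite ffunE G0.
apply/'forall_'forall_'forall_implyP => w i k asc.
by rewrite !ffunE (G1 _ _ _ asc).
Qed.

Definition grothendieck w : {mpoly int[n]} :=
  xchoose grothendieck_family_exists w.

Lemma grothendieck_longest : grothendieck (longest_perm n) = staircase_monomial.
Proof. by have /andP[/eqP] := xchooseP grothendieck_family_exists. Qed.

Lemma grothendieck_ascent w i k : is_ascent w i k ->
  grothendieck w = isobaric_ddiff i k (grothendieck (tperm i k * w)%g).
Proof.
have /andP[_ /'forall_'forall_'forall_implyP H] :=
  xchooseP grothendieck_family_exists.
by move=> /H/eqP.
Qed.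

End Grothendieck.

Section PipeDreams.
Variable n : nat.
Local Notation cell := ('I_n * 'I_n)%type.
Implicit Types P : {set cell}.

(* A pipe dream is given by the set P of its crossing tiles; the other cells  *)
(* above the antidiagonal carry bump tiles.                                   *)
Definition is_pipe_dream P : bool :=
  [forall c in P, (c.1.+1 + c.2.+1 <= n)%N].

(* A state of the tracing of the pipes: the label of the pipe which is        *)
(* travelling down in each column, the label of the pipe which is travelling  *)
(* left in each row, and the pairs of pipes that have already crossed.        *)
Record trace_state := TraceState {
  down_pipe : {ffun 'I_n -> 'I_n};
  left_pipe : {ffun 'I_n -> 'I_n};
  crossed : {set {set 'I_n}} }.

Definition put (f : {ffun 'I_n -> 'I_n}) (k v : 'I_n) : {ffun 'I_n -> 'I_n} :=
  [ffun l => if l == k then v else f l].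

Definition trace_tile P (s : trace_state) (c : cell) : trace_state :=
  let: (i, j) := c in
  let: TraceState d l X := s in
  if (n < i + j + 1)%N then s
  else if (i + j + 1 == n)%N then (* half-bump tile *)
    TraceState d (put l i (d j)) X
  else if (c \in P) && ([set d j; l i] \notin X) then (* pipes cross *)
    TraceState d l ([set d j; l i] |: X)
  else (* bump tile, or crossing tile treated as one *)
    TraceState (put d j (l i)) (put l i (d j)) X.

(* All cells, rows from top to bottom, each row from right to left.           *)
Definition trace_order : seq cell :=
  [seq (i, j) | i <- enum 'I_n, j <- rev (enum 'I_n)].

(* The initial value of left_pipe is irrelevant: the first tile met in a row  *)
(* is its half-bump tile.                                                     *)
Definition trace_pipes P : trace_state :=
  foldl (trace_tile P)
    (TraceState [ffun j => j] [ffun i => i] set0) trace_order.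

Definition PD (w : 'S_n) : {set {set cell}} :=
  [set P | is_pipe_dream P & [forall i, left_pipe (trace_pipes P) i == w i]].

Definition pd_weight P : 'X_{1..n} :=
  [multinom #|[set j | (i, j) \in P]| | i < n].

Definition PD_of_weight (w : 'S_n) (alpha : 'X_{1..n}) : {set {set cell}} :=
  [set P in PD w | pd_weight P == alpha].

End PipeDreams.

Section GraveDiagrams.
Variable n : nat.
Local Notation cell := ('I_n * 'I_n)%type.

(* (boxes, ghosts); disjointness holds throughout KKoh and GKKoh, see         *)
(* GKKoh_disjoint below.                                                      *)
Definition grave_diagram : finType := ({set cell} * {set cell})%type.
Implicit Types (E F : grave_diagram) (i j r : 'I_n).

Definition boxes E : {set cell} := E.1.
Definition ghosts E : {set cell} := E.2.
Definition occupied E : {set cell} := boxes E :|: ghosts E.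

Definition grave_weight E : 'X_{1..n} :=
  [multinom #|[set j | (i, j) \in occupied E]| | i < n].

Definition rothe_diagram (w : 'S_n) : {set cell} :=
  [set c : cell | (c.1 < (w^-1)%g c.2)%N && (c.2 < w c.1)%N].

Definition rightmost_occupied E i j : bool :=
  ((i, j) \in occupied E)
  && [forall j' : 'I_n, ((i, j') \in occupied E) ==> (j' <= j)%N].

(* i' = max {r | r < i, (r, j) not occupied}; false if there is no such r.    *)
Definition landing_row E i j i' : bool :=
  [&& (i' < i)%N, (i', j) \notin occupied E &
    [forall r : 'I_n, ((r < i)%N && ((r, j) \notin occupied E)) ==> (r <= i')%N]].

Definition box_movable E i j i' : bool :=
  [&& (i, j) \in boxes E, rightmost_occupied E i j, landing_row E i j i' &
    [forall r : 'I_n, (i' < r <= i)%N && ((r, j) \in occupied E)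
       ==> ((r, j) \in boxes E)]].

Definition ghost_movable E i j i' : bool :=
  [&& (i, j) \in ghosts E, rightmost_occupied E i j, landing_row E i j i' &
    [forall r : 'I_n, (i' < r < i)%N && ((r, j) \in occupied E)
       ==> ((r, j) \in ghosts E)]].

Definition kohnert_move : rel grave_diagram := fun E F =>
  [exists i, exists j, exists i', box_movable E i j i' &&
    (F == ((i', j) |: (boxes E :\ (i, j)), ghosts E))].

Definition K_kohnert_move : rel grave_diagram := fun E F =>
  [exists i, exists j, exists i', box_movable E i j i' &&
    (F == ((i', j) |: (boxes E :\ (i, j)), (i, j) |: ghosts E))].

Definition ghost_kohnert_move : rel grave_diagram := fun E F =>
  [exists i, exists j, exists i', ghost_movable E i j i' &&
    (F == (boxes E, (i', j) |: (ghosts E :\ (i, j))))].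

Definition ghost_K_kohnert_move : rel grave_diagram := fun E F =>
  [exists i, exists j, exists i', ghost_movable E i j i' &&
    (F == (boxes E, (i', j) |: ghosts E))].

Definition box_move : rel grave_diagram := fun E F =>
  kohnert_move E F || K_kohnert_move E F.

Definition grave_move : rel grave_diagram := fun E F =>
  [|| kohnert_move E F, K_kohnert_move E F,
      ghost_kohnert_move E F | ghost_K_kohnert_move E F].

Definition initial_diagram (w : 'S_n) : grave_diagram := (rothe_diagram w, set0).

Definition KKoh (w : 'S_n) : {set grave_diagram} :=
  [set E | connect box_move (initial_diagram w) E].

Definition GKKoh (w : 'S_n) : {set grave_diagram} :=
  [set E | connect grave_move (initial_diagram w) E].

Definition KKoh_of_weight (w : 'S_n) (alpha : 'X_{1..n}) : {set grave_diagram} :=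
  [set E in KKoh w | grave_weight E == alpha].

Definition GKKoh_of_weight (w : 'S_n) (alpha : 'X_{1..n}) : {set grave_diagram} :=
  [set E in GKKoh w | grave_weight E == alpha].

Lemma KKoh_sub_GKKoh w : KKoh w \subset GKKoh w.
Proof.
apply/subsetP => E; rewrite !inE; apply: connect_sub => {}E F mEF.
by apply: connect1; rewrite /grave_move; case/orP: mEF => ->; rewrite ?orbT.
Qed.

Lemma grave_move_disjoint E F : grave_move E F ->
  [disjoint boxes E & ghosts E] -> [disjoint boxes F & ghosts F].
Proof.
have H (B C : {set cell}) c d :
    c \notin B :|: C -> c != d -> [disjoint B & C] ->
    [/\ [disjoint c |: (B :\ d) & C], [disjoint c |: (B :\ d) & d |: C],
        [disjoint B & c |: (C :\ d)] & [disjoint B & c |: C]].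
  rewrite inE negb_or => /andP[cB cC] cd BC.
  have K (x : cell) : (x \in B) && (x \in C) = false.
    by apply/negP => /andP[xB]; rewrite (disjointFr BC xB).
  by split; apply/pred0P => x /=; rewrite !inE; have := K x;
    case: (x =P c) => [->|_];
    rewrite ?(negbTE cB) ?(negbTE cC) ?(negbTE cd) ?andbF //=;
    case: (x == d); case: (x \in B); case: (x \in C).
move=> m dE.
have L i j i' : landing_row E i j i' ->
    (i', j) \notin boxes E :|: ghosts E /\ (i', j) != (i, j).
  by case/and3P => lt -> _; split=> //; apply/eqP => -[e]; rewrite e ltnn in lt.
by case/or4P: m => /existsP[i /existsP[j /existsP[i' /andP[/and4P[_ _ l _] /eqP->]]]];
  have [l1 l2] := L _ _ _ l; have [] := H _ _ _ _ l1 l2 dE.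
Qed.

Lemma GKKoh_disjoint w E : E \in GKKoh w -> [disjoint boxes E & ghosts E].
Proof.
rewrite inE => /connectP[p]; have : [disjoint boxes (initial_diagram w) &
    ghosts (initial_diagram w)] by rewrite -setI_eq0 setI0.
elim: p (initial_diagram w) => [|F p IH] E0 d /=; first by move=> _ ->.
by case/andP => m; apply: IH; apply: grave_move_disjoint d.
Qed.

End GraveDiagrams.

(* Main.v *)
From HB Require Import structures.
Require Import Defs.
From mathcomp Require Import all_boot all_order all_algebra all_fingroup.
From mathcomp Require Import zify ring.
From mathcomp Require Import mpoly.

(* Fillings T assign to each inversion (i, k) of w a nonempty set of rows     *)
(* <= i, weakly decreasing along the rows of the Rothe diagram and strictly   *)
(* increasing down its columns; T (i, k) lists the rows occupied by the box   *)
(* of row i and column w k together with the ghosts that it has left behind.  *)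
(* When w avoids 1432, every Kohnert move, ghost or not, keeps a diagram of   *)
(* this form, and every filling is reached by box moves alone: so both KKoh   *)
(* and GKKoh are in bijection with the fillings.  The fillings and the pipe   *)
(* dreams have the same generating function, because both satisfy the         *)
(* recursion obtained by removing the tiles of a pipe dream one by one in     *)
(* reading order; for fillings, removing the tile (r, b - r) removes the      *)
(* entry r from the cell whose row and column carry the values b + 1 and b.   *)
(* Finally the generating function of pipe dreams is the image of the         *)
(* identity under a product of operators 1 + x u of the 0-Hecke algebra; the  *)
(* Yang-Baxter equation makes it symmetric up to a factor 1 + x u, which is   *)
(* the Grothendieck recursion (Fomin and Kirillov).                           *)

Set Implicit Arguments.
Unset Strict Implicit.
Unset Printing Implicit Defensive.

Import GRing.Theory.

Local Open Scope nat_scope.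
Local Open Scope ring_scope.

(** * Hecke operators and the Yang-Baxter equation *)

(** Everything is compared with [hecke_sum y], the element of the 0-Hecke algebra obtained from the
    identity by the factors 1 + y_i u_(i+j), one for each cell (i, j) strictly above the
    antidiagonal, in reading order. The permutation of a pipe dream is a Demazure product
    ([trace_pipesE]), so the coordinate at w sums y^wt(P) over the pipe dreams P of w ([PD_sum]).

    Grothendieck side: by the Yang-Baxter equation, two rows with the same letters and different
    variables commute ([row_word_swap]). One extra factor therefore makes the product symmetric in
    two consecutive variables, and its coordinates at w and w s_i give the isobaric recursion. With
    y_i = -x_i, the coordinate at w is G_w up to the sign (-1)^l(w) ([grothendieck_hecke]).

    Diagram side: a filling records, for each box of D(w), the rows of the box and its ghosts. A
    diagram determines its filling ([diagram_inj]), and every filling is reached by box moves, which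
    are undone one at a time ([diagram_KKoh]). Conversely a ghost moves within the set of its own
    cell ([ghost_closed]), and a box jumping over others is read as a shift of all of them by one
    row, which 1432-avoidance makes compatible with the rows ([box_closed]). Hence KKoh and GKKoh
    are the same set.

    The bridge is [filling_sum_step]: the sum over fillings is peeled tile by tile by left
    multiplications 1 + y u. This works because avoidance puts the relevant cell at the top of its
    column. The permutations met on the way satisfy only a weakened avoidance condition,
    [peelable]. *)

Section AdjacentTranspositions.
Variable n : nat.
Implicit Types (w : 'S_n) (b : nat).

(* Junk value outside of b.+1 < n: the identity, which has no descent at b. *)
Definition adj b : 'S_n :=
  if (insub b, insub b.+1) is (Some i, Some k) then tperm i k else 1%g.

Definition rdesc b w : bool :=
  if (insub b, insub b.+1) is (Some i, Some k) then (w k < w i)%N else false.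

Lemma adjE (i k : 'I_n) : k = i.+1 :> nat -> adj i = tperm i k.
Proof.
move=> e; rewrite /adj -e.
by case: insubP => [i' _ /val_inj->|]; rewrite ?ltn_ord //;
  case: insubP => [k' _ /val_inj->|]; rewrite ?ltn_ord.
Qed.

Lemma rdescE (i k : 'I_n) w : k = i.+1 :> nat -> rdesc i w = (w k < w i)%N.
Proof.
move=> e; rewrite /rdesc -e.
by case: insubP => [i' _ /val_inj->|]; rewrite ?ltn_ord //;
  case: insubP => [k' _ /val_inj->|]; rewrite ?ltn_ord.
Qed.

Lemma rdesc_out b w : (n <= b.+1)%N -> rdesc b w = false.
Proof.
move=> le; rewrite /rdesc; case: insubP => // i _ _.
by case: insubP => // k lt; lia.
Qed.

Lemma adj_out b : (n <= b.+1)%N -> adj b = 1%g.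
Proof.
move=> le; rewrite /adj; case: insubP => // i _ _.
by case: insubP => // k lt; lia.
Qed.

Variant adj_spec b : Prop :=
  | AdjIn (i k : 'I_n) of b = i :> nat & k = i.+1 :> nat
  | AdjOut of (n <= b.+1)%N.

Lemma adjP b : adj_spec b.
Proof.
have [lt|le] := ltnP b.+1 n; last exact: AdjOut.
exact: (@AdjIn _ (Ordinal (ltnW lt)) (Ordinal lt)).
Qed.

Lemma adjK b : (adj b * adj b = 1)%g.
Proof. by rewrite /adj; case: insub => [i|]; rewrite ?mulg1 //; case: insub => [k|]; rewrite ?mulg1 ?tperm2. Qed.

Lemma adjV b : ((adj b)^-1 = adj b)%g.
Proof. by apply/eqP; rewrite eq_invg_mul adjK. Qed.

End AdjacentTranspositions.

Section HeckeModule.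
Variables (R : comNzRingType) (M : lmodType R) (W : Type) (ev : W -> M -> R).
Hypothesis ev_inj : forall f g, (forall w, ev w f = ev w g) -> f = g.
Hypothesis evD : forall w f g, ev w (f + g) = ev w f + ev w g.
Hypothesis evN : forall w f, ev w (- f) = - ev w f.
Hypothesis evZ : forall w x f, ev w (x *: f) = x * ev w f.
Variables u v : M -> M.
Hypotheses (uD : forall f g, u (f + g) = u f + u g)
  (uN : forall f, u (- f) = - u f) (uZ : forall x f, u (x *: f) = x *: u f)
  (vD : forall f g, v (f + g) = v f + v g)
  (vN : forall f, v (- f) = - v f) (vZ : forall x f, v (x *: f) = x *: v f).
Hypotheses (uu : forall f, u (u f) = u f) (vv : forall f, v (v f) = v f)
  (uvu : forall f, u (v (u f)) = v (u (v f))).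

(** The relations reduce both sides to combinations of words in [u] and [v] applied to f. Reading
    coordinates through [ev] turns these words into scalar atoms, so that a polynomial identity
    remains. *)
Lemma yang_baxter_module (x y : R) (f : M)
  (U := fun z g => g + z *: u g) (V := fun z g => g + z *: v g) :
  (1 + x) *: U y (V y (U x ((1 + y) *: f - y *: v f)))
  = (1 + y) *: U x (V x (U y ((1 + x) *: f - x *: v f))).
Proof.
apply: ev_inj => w; rewrite {}/U {}/V.
rewrite !(uD, uN, uZ, vD, vN, vZ) !(uu, vv) -!uvu !(uu, vv) !(evD, evN, evZ).
ring.
Qed.

End HeckeModule.

(** * The 0-Hecke algebra acting on functions on the symmetric group *)

Section HeckeOperators.
Variables (n : nat) (R : comNzRingType).
Local Notation fspace := {ffun 'S_n -> R^o}.
Implicit Types (w : 'S_n) (b : nat) (f g : fspace) (x y : R).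

(** On the element sum_w f(w) w of the 0-Hecke algebra with u_b^2 = u_b, this is right
    multiplication by u_b, which sends w to w s_b at an ascent and fixes w at a descent; [lhecke] is
    left multiplication. *)
Definition hecke b f : fspace :=
  [ffun w => if rdesc b w then f w + f (adj n b * w)%g else 0].
Definition lhecke b f : fspace :=
  [ffun w => if rdesc b (w^-1)%g then f w + f (w * adj n b)%g else 0].

Definition hstep b x f : fspace := f + x *: hecke b f.
Definition lhstep b x f : fspace := f + x *: lhecke b f.

Lemma hecke_is_linear b : linear (hecke b).
Proof.
move=> x f g; apply/ffunP => w; rewrite !ffunE /=; case: ifP => _.
  by rewrite /GRing.scale /=; ring.
by rewrite scaler0 addr0.
Qed.
HB.instance Definition _ b :=
  GRing.isLinear.Build R fspace fspace _ (hecke b) (@hecke_is_linear b).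

Lemma heckeD b f g : hecke b (f + g) = hecke b f + hecke b g.
Proof. exact: linearD. Qed.

Lemma heckeN b f : hecke b (- f) = - hecke b f.
Proof. exact: linearN. Qed.

Lemma heckeZ b x f : hecke b (x *: f) = x *: hecke b f.
Proof. exact: linearZ. Qed.

Lemma lhecke_is_linear b : linear (lhecke b).
Proof.
move=> x f g; apply/ffunP => w; rewrite !ffunE /=; case: ifP => _.
  by rewrite /GRing.scale /=; ring.
by rewrite scaler0 addr0.
Qed.
HB.instance Definition _ b :=
  GRing.isLinear.Build R fspace fspace _ (lhecke b) (@lhecke_is_linear b).

Lemma hstep_is_linear b x : linear (hstep b x).
Proof.
move=> c f g; rewrite /hstep linearP; apply/ffunP => w; rewrite !ffunE.
by rewrite /GRing.scale /=; ring.
Qed.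
HB.instance Definition _ b x :=
  GRing.isLinear.Build R fspace fspace _ (hstep b x) (@hstep_is_linear b x).

Lemma hecke_out b f : (n <= b.+1)%N -> hecke b f = 0.
Proof. by move=> le; apply/ffunP => w; rewrite !ffunE rdesc_out. Qed.

Lemma hecke_idem b f : hecke b (hecke b f) = hecke b f.
Proof.
case: (adjP n b) => [i k -> ek|le]; last by rewrite !hecke_out.
apply/ffunP => w; rewrite !ffunE !(rdescE _ ek) (adjE ek) !permM tpermL tpermR.
by case: (ltngtP (w k) (w i)) => // _; rewrite addr0.
Qed.

Lemma adj_nat (i k : 'I_n) : k = i.+1 :> nat -> (i != k)%N.
Proof. by move=> e; apply/eqP => e'; rewrite e' in e; lia. Qed.

Lemma hecke_comm b c f : (b.+1 < c)%N -> hecke b (hecke c f) = hecke c (hecke b f).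
Proof.
case: (adjP n b) => [i k -> ek|le]; last by rewrite !(hecke_out _ le) linear0.
case: (adjP n c) => [i' k' -> ek' lt|le']; last by rewrite !(hecke_out _ le') linear0.
have [n1 n2 n3 n4] : [/\ i != i', i != k', k != i' & k != k'].
  by split; apply/eqP => e; move: ek ek' lt; rewrite e; lia.
have [m1 m2 m3 m4] : [/\ i' != i, k' != i, i' != k & k' != k] by split; rewrite eq_sym.
apply/ffunP => w; rewrite !ffunE !(rdescE _ ek) !(rdescE _ ek') (adjE ek) (adjE ek').
rewrite !permM !(tpermD n1 n3, tpermD n2 n4, tpermD m1 m2, tpermD m3 m4).
case: ifP => _; case: ifP => _; rewrite ?addr0 //.
suff -> : (tperm i k * (tperm i' k' * w) = tperm i' k' * (tperm i k * w))%g by ring.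
by rewrite !mulgA (conjgC (tperm i' k')) tpermJ !tpermD.
Qed.

Lemma hecke_braid b f :
  hecke b (hecke b.+1 (hecke b f)) = hecke b.+1 (hecke b (hecke b.+1 f)).
Proof.
case: (adjP n b.+1) => [j k ej ek|le]; last by rewrite !(hecke_out _ le) linear0.
case: (adjP n b) => [i j' ei ej'|le]; last by move: (ltn_ord k); lia.
have ejj : j' = j by apply/val_inj => /=; lia.
subst j'; rewrite {ej}ei in ej *; rewrite -ej'.
have nij := adj_nat ej'; have njk := adj_nat ek.
have nik : i != k by apply/eqP => e; move: ek ej'; rewrite e; lia.
have [nji nkj nki] : [/\ j != i, k != j & k != i] by split; rewrite eq_sym.
have ti : tperm j k i = i by rewrite tpermD.
have tk : tperm i j k = k by rewrite tpermD.
have br : (tperm j k * tperm i j * tperm j k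
            = tperm i j * tperm j k * tperm i j)%g.
  have Jab : (tperm i j ^ tperm j k = tperm i k)%g by rewrite tpermJ tpermL ti.
  have Jbc : (tperm j k ^ tperm i j = tperm i k)%g by rewrite tpermJ tpermR tk.
  by move: Jab Jbc; rewrite !conjgE !tpermV !mulgA => -> ->.
apply/ffunP => w; rewrite !ffunE !(rdescE _ ej') !(rdescE _ ek) (adjE ek) (adjE ej').
rewrite !permM !(tpermL, tpermR, ti, tk).
have aa (s : 'S_n) : (tperm i j * (tperm i j * s) = s)%g by rewrite mulgA tperm2 mul1g.
have bb (s : 'S_n) : (tperm j k * (tperm j k * s) = s)%g by rewrite mulgA tperm2 mul1g.
have bab (s : 'S_n) : (tperm j k * (tperm i j * (tperm j k * s))
    = tperm i j * (tperm j k * (tperm i j * s)))%g by rewrite !mulgA br.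
rewrite !(aa, bb, bab).
have inj (u v : 'I_n) : u != v -> w u != w v :> nat.
  by rewrite -(inj_eq (@perm_inj _ w)) -(inj_eq val_inj).
have := inj _ _ nij; have := inj _ _ njk; have := inj _ _ nik.
case: (ltngtP (w i) (w j)) => //; case: (ltngtP (w j) (w k)) => //;
  case: (ltngtP (w i) (w k)) => //=; intros; try lia; ring.
Qed.

Lemma lt_adjacent_tperm (u v p q : 'I_n) : v = u.+1 :> nat ->
    (p, q) != (u, v) -> (p, q) != (v, u) ->
  (tperm u v p < tperm u v q)%N = (p < q)%N.
Proof.
move=> ev; rewrite !xpair_eqE.
have val_eq (x y : 'I_n) : (x == y) = (x == y :> nat) by [].
have ne (x y : 'I_n) : x <> y -> x <> y :> nat by move=> h /val_inj.
case: (tpermP u v p) => [->|->|/ne n1 /ne n2];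
  case: (tpermP u v q) => [->|->|/ne n3 /ne n4];
  rewrite ?eqxx ?ltnn //=; rewrite ?val_eq; lia.
Qed.

Lemma lhecke_hecke b c f : lhecke b (hecke c f) = hecke c (lhecke b f).
Proof.
case: (adjP n c) => [i k -> ek|le]; last by rewrite !(hecke_out _ le) linear0.
case: (adjP n b) => [u v -> ev|le]; last first.
  by apply/ffunP => w; rewrite !ffunE !(rdesc_out _ le) addr0 if_same.
apply/ffunP => w; rewrite !ffunE !invMg !adjV.
rewrite !(rdescE _ ek) !(rdescE _ ev) (adjE ek) (adjE ev) !permM.
have ltik : (i < k)%N by rewrite ek.
have ltuv : (u < v)%N by rewrite ev.
have gtki : (k < i)%N = false by rewrite ltnNge ltnW.
have gtvu : (v < u)%N = false by rewrite ltnNge ltnW.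
(* The two multiplications interfere only when w maps {i, k} onto {u, v}; otherwise neither exchange
   affects the descent tested by the other. *)
have [/eqP [e1 e2]|n1] := boolP ((w i, w k) == (u, v)).
  by rewrite -e1 -e2 !permK e1 e2 gtki gtvu.
have [/eqP [e1 e2]|n2] := boolP ((w i, w k) == (v, u)).
  have e3 : (w * tperm u v = tperm i k * w)%g.
    by rewrite [RHS]conjgC tpermJ e1 e2 tpermC.
  have e4 : (tperm i k * (tperm i k * w) = w)%g by rewrite mulgA tperm2 mul1g.
  have e5 : (tperm i k * w * tperm u v = w)%g by rewrite -mulgA e3 e4.
  rewrite e3 e4 e5.
  rewrite -e1 -e2 !permK e1 e2 !tpermL !tpermR ltik ltuv.
  by rewrite gtki gtvu !addr0.
have -> : (tperm u v (w k) < tperm u v (w i))%N = (w k < w i)%N.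
  by rewrite lt_adjacent_tperm // xpair_eqE andbC -xpair_eqE.
have -> : (tperm i k (w^-1 v)%g < tperm i k (w^-1 u)%g)%N = ((w^-1)%g v < (w^-1)%g u)%N.
  rewrite lt_adjacent_tperm //.
    apply: contra n2; rewrite !xpair_eqE => /andP[/eqP<- /eqP<-].
    by rewrite !permKV !eqxx.
  apply: contra n1; rewrite !xpair_eqE => /andP[/eqP<- /eqP<-].
  by rewrite !permKV !eqxx.
by rewrite !mulgA; case: ifP => _; case: ifP => _; rewrite ?addr0 //; ring.
Qed.

Lemma hstep_out b x f : (n <= b.+1)%N -> hstep b x f = f.
Proof. by move=> le; rewrite /hstep hecke_out // scaler0 addr0. Qed.

Lemma hstep_comm b c x y f : (b.+1 < c)%N ->
  hstep b x (hstep c y f) = hstep c y (hstep b x f).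
Proof.
move=> lt; rewrite /hstep !linearD !linearZ /= (hecke_comm _ lt).
by rewrite !scalerA (mulrC y) addrACA.
Qed.

Lemma lhstep_hstep b c x y f : lhstep b x (hstep c y f) = hstep c y (lhstep b x f).
Proof.
rewrite /hstep /lhstep !linearD !linearZ /= lhecke_hecke.
by rewrite !scalerA (mulrC y) addrACA.
Qed.

Definition delta : fspace := [ffun w => (w == 1%g)%:R].

Lemma rdesc1 b : rdesc b (1%g : 'S_n) = false.
Proof.
case: (adjP n b) => [i k -> ek|]; last exact: rdesc_out.
by rewrite (rdescE _ ek) !perm1 ek ltnNge leqnSn.
Qed.

Lemma lhecke_delta b : lhecke b delta = hecke b delta.
Proof.
apply/ffunP => w; rewrite !ffunE.
have -> : (w * adj n b == 1)%g = (w == adj n b) by rewrite -eq_invg_mul -[X in _ == X]adjV (inj_eq invg_inj).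
have -> : (adj n b * w == 1)%g = (w == adj n b) by rewrite -eq_invg_mul adjV eq_sym.
case: (w =P 1%g) => [->|_]; first by rewrite invg1 rdesc1.
by case: eqP => [->|_]; rewrite ?adjV // addr0 !if_same.
Qed.

Definition word_act (s : seq (nat * R)) f : fspace :=
  foldl (fun f c => hstep c.1 c.2 f) f s.

Lemma word_act_cat s t f : word_act (s ++ t) f = word_act t (word_act s f).
Proof. exact: foldl_cat. Qed.

(** Left and right multiplications commute and agree on the identity, so a word can also be built
    from its last letter. The first letter then becomes the outermost operator, which allows peeling
    in reading order. *)
Lemma word_act_delta s :
  word_act s delta = foldr (fun c f => lhstep c.1 c.2 f) delta s.
Proof.
elim/last_ind: s => // s [b x] IH; rewrite /word_act -cats1 foldl_cat foldr_cat /=.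
rewrite -/(word_act s delta) IH.
have -> : lhstep b x delta = hstep b x delta by rewrite /lhstep /hstep lhecke_delta.
by elim: s {IH} => //= -[c y] s IHs /=; rewrite -lhstep_hstep IHs.
Qed.

(** Read from right to left, the tiles (k, j) of row k carry the letters k + j, from n - 2 down to
    k. *)
Definition row_word k x : seq (nat * R) := [seq (b, x) | b <- rev (iota k (n.-1 - k))].

Lemma row_word_act k x f :
  word_act (row_word k x) f = hstep k x (word_act (row_word k.+1 x) f).
Proof.
have [lt|le] := ltnP k.+1 n; last first.
  rewrite hstep_out // /row_word.
  have [-> ->] : (n.-1 - k = 0 /\ n.-1 - k.+1 = 0)%N by lia.
  by [].
have -> : row_word k x = row_word k.+1 x ++ [:: (k, x)].
  rewrite /row_word; have -> : (n.-1 - k = (n.-1 - k.+1).+1)%N by lia.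
  by rewrite /= rev_cons -cats1 map_cat.
by rewrite word_act_cat.
Qed.

Lemma row_word_hstep k c x y f : (c.+1 < k)%N ->
  word_act (row_word k x) (hstep c y f) = hstep c y (word_act (row_word k x) f).
Proof.
rewrite /row_word; set s := rev _ => lt.
have : all (fun b => c.+1 < b)%N s.
  by apply/allP => b; rewrite mem_rev mem_iota; lia.
elim: s f => //= b s IH f /andP[ltb /IH {}IH]; rewrite -hstep_comm //.
Qed.

Lemma hstepZ b x c f : hstep b x (c *: f) = c *: hstep b x f.
Proof. exact: linearZ. Qed.

Lemma ffun_scaleE x f w : (x *: f) w = x * f w.
Proof. by rewrite ffunE. Qed.

Lemma ffun_addE f g w : (f + g) w = f w + g w.
Proof. by rewrite ffunE. Qed.

Lemma ffun_oppE f w : (- f) w = - f w.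
Proof. by rewrite ffunE. Qed.

Definition ffunopE := (ffun_scaleE, ffun_addE, ffun_oppE).

(** As u is idempotent, 1 + x u has the inverse 1 - x/(1 + x) u; clearing the denominator keeps the
    formula in R. *)
Lemma hstep_inv b x f (h := hstep b x f) :
  (1 + x) *: f = (1 + x) *: h - x *: hecke b h.
Proof.
rewrite {}/h /hstep heckeD heckeZ hecke_idem; move: (hecke _ f) => f'.
by apply/ffunP => w; rewrite !ffunopE; ring.
Qed.

(* The operator (1 + y) - y u is (1 + y) times the inverse of 1 + y u.        *)
Lemma yang_baxter_scaled b x y f :
  (1 + x) *: hstep b y (hstep b.+1 y (hstep b x ((1 + y) *: f - y *: hecke b.+1 f)))
  = (1 + y) *: hstep b x (hstep b.+1 x (hstep b y ((1 + x) *: f - x *: hecke b.+1 f))).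
Proof.
have ev_inj (g h : fspace) : (forall w, g w = h w :> R) -> g = h by move/ffunP.
exact: (@yang_baxter_module R fspace _ (fun w h => h w) ev_inj
  (fun w g h => ffun_addE g h w) (fun w g => ffun_oppE g w)
  (fun w c g => ffun_scaleE c g w) (hecke b) (hecke b.+1)
  (heckeD b) (heckeN b) (heckeZ b) (heckeD b.+1) (heckeN b.+1) (heckeZ b.+1)
  (hecke_idem b) (hecke_idem b.+1) (hecke_braid b) x y f).
Qed.

End HeckeOperators.

(** * Commutation of two rows *)

Section YangBaxter.
Variables (n : nat) (R : idomainType).
Local Notation fspace := {ffun 'S_n -> R^o}.
Implicit Types (b k : nat) (f g h : fspace) (x y : R).

Lemma ffun_scalerI x (f g : fspace) : x != 0 -> x *: f = x *: g -> f = g.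
Proof.
move=> nx e; apply/ffunP => w; apply: (mulfI nx).
have E (p : fspace) : x * p w = (x *: p) w by rewrite [RHS]ffunE.
by rewrite !E e.
Qed.

(** With h_b(x) = 1 + x u_b, this is the symmetry in x and y of h_b(y) h_(b+1)(y) h_b(x)
    h_(b+1)(y)^-1, stated without inverses: g and g' are the images of one vector under the inverses
    of h_(b+1)(y) and h_(b+1)(x). *)
Lemma yang_baxter b x y g g' : 1 + x != 0 -> 1 + y != 0 ->
    hstep b.+1 y g = hstep b.+1 x g' ->
  hstep b y (hstep b.+1 y (hstep b x g)) = hstep b x (hstep b.+1 x (hstep b y g')).
Proof.
move=> nx ny e; set h := hstep b.+1 y g in e.
have E z f : hstep b.+1 z f = h -> (1 + z) *: f = (1 + z) *: h - z *: hecke b.+1 h.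
  by move=> <-; exact: hstep_inv.
have Eg := E _ _ erefl; have Eg' := E _ _ (esym e).
have nxy : (1 + x) * (1 + y) != 0 by rewrite mulf_neq0.
suff : (1 + x) *: hstep b y (hstep b.+1 y (hstep b x ((1 + y) *: g)))
     = (1 + y) *: hstep b x (hstep b.+1 x (hstep b y ((1 + x) *: g'))).
  rewrite !hstepZ !scalerA (mulrC (1 + y)).
  exact: ffun_scalerI.
by rewrite Eg Eg'; exact: yang_baxter_scaled.
Qed.

(** Downward induction on k. The letters at least k + 2 of the second row pass through the letter k
    of the first, so the last three factors have letters k, k + 1, k; the case k + 1 is then the
    hypothesis of [yang_baxter]. *)
Lemma row_word_swap k x y f : 1 + x != 0 -> 1 + y != 0 ->
  word_act (row_word n k x ++ row_word n k y) f
  = word_act (row_word n k y ++ row_word n k x) f.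
Proof.
move=> nx ny; have [m] := ubnP (n - k); elim: m k => // m IH k lem.
have [lt|le] := ltnP k.+1 n; last first.
  by rewrite /row_word; have -> : (n.-1 - k = 0)%N by lia.
pose g x y := word_act (row_word n k.+2 y) (word_act (row_word n k.+1 x) f).
have E z t : word_act (row_word n k z ++ row_word n k t) f
    = hstep k t (hstep k.+1 t (hstep k z (g z t))).
  rewrite word_act_cat (row_word_act k z) (row_word_act k t); congr (hstep _ _ _).
  rewrite (row_word_act k.+1 t); congr (hstep _ _ _); exact: row_word_hstep.
rewrite !E; apply: yang_baxter => //.
have /IH : (n - k.+1 < m)%N by lia.
by rewrite !word_act_cat (row_word_act k.+1 y) [RHS](row_word_act k.+1 x).
Qed.

End YangBaxter.

(** * Grothendieck polynomials as Hecke sums *)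

Section OrdinalEnumeration.
Variable n : nat.

Lemma enum_ord_split (i : 'I_n) :
  enum 'I_n = take i (enum 'I_n) ++ i :: drop i.+1 (enum 'I_n).
Proof.
rewrite -{1}(cat_take_drop i (enum 'I_n)) (drop_nth i) ?size_enum_ord //.
by rewrite nth_ord_enum.
Qed.

Lemma mem_take_enum_ord m (i : 'I_n) : (i \in take m (enum 'I_n)) = (i < m)%N.
Proof.
rewrite -(mem_map val_inj) map_take val_enum_ord take_iota mem_iota /=.
by have := ltn_ord i; lia.
Qed.

Lemma mem_drop_enum_ord m (i : 'I_n) : (i \in drop m (enum 'I_n)) = (m <= i)%N.
Proof.
rewrite -(mem_map val_inj) map_drop val_enum_ord drop_iota mem_iota /=.
by have := ltn_ord i; lia.
Qed.

End OrdinalEnumeration.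

Section StaircaseWord.
Variables (n : nat) (R : comNzRingType).
Implicit Types (y : 'I_n -> R) (s : seq 'I_n) (x : R) (f : {ffun 'S_n -> R^o}).

Definition rows_word y s : seq (nat * R) := flatten [seq row_word n i (y i) | i : 'I_n <- s].

Definition hecke_sum y : {ffun 'S_n -> R^o} :=
  word_act (rows_word y (enum 'I_n)) (delta n R).

Lemma rows_word_cat y s t : rows_word y (s ++ t) = rows_word y s ++ rows_word y t.
Proof. by rewrite /rows_word map_cat flatten_cat. Qed.

Lemma rows_word_cons y i s : rows_word y (i :: s) = row_word n i (y i) ++ rows_word y s.
Proof. by []. Qed.

Lemma rows_word_hstep y s c x f : {in s, forall i : 'I_n, (c.+1 < i)%N} ->
  word_act (rows_word y s) (hstep c x f) = hstep c x (word_act (rows_word y s) f).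
Proof.
elim: s f => [|i s IH] f lt; first by [].
rewrite rows_word_cons !word_act_cat row_word_hstep ?lt ?mem_head //.
by apply: IH => j js; rewrite lt // inE js orbT.
Qed.

End StaircaseWord.

Section HeckeMorphism.
Variables (n : nat) (R S : comNzRingType) (sigma : {rmorphism R -> S}).

Lemma hstep_map b x (f : {ffun 'S_n -> R^o}) (g : {ffun 'S_n -> S^o}) :
  (forall w, sigma (f w) = g w) ->
  forall w, sigma (hstep b x f w) = hstep b (sigma x) g w.
Proof.
move=> e w; rewrite !ffun_addE !ffun_scaleE rmorphD rmorphM !ffunE -!e.
by case: ifP => _; rewrite ?rmorph0 // rmorphD.
Qed.

Lemma row_word_map k x z (f : {ffun 'S_n -> R^o}) (g : {ffun 'S_n -> S^o}) :
    sigma x = z -> (forall w, sigma (f w) = g w) ->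
  forall w, sigma (word_act (row_word n k x) f w) = word_act (row_word n k z) g w.
Proof.
move=> <-; rewrite /row_word; elim: (rev _) f g => //= b t IHt f g fg.
by apply: IHt; apply: hstep_map.
Qed.

Lemma rows_word_map (y : 'I_n -> R) (z : 'I_n -> S) s
    (f : {ffun 'S_n -> R^o}) (g : {ffun 'S_n -> S^o}) :
    {in s, forall i, sigma (y i) = z i} ->
  (forall w, sigma (f w) = g w) ->
  forall w, sigma (word_act (rows_word y s) f w) = word_act (rows_word z s) g w.
Proof.
elim: s f g => [|i s IH] f g yz fg; first by [].
rewrite !rows_word_cons !word_act_cat; apply: IH => [j js|].
  by rewrite yz // inE js orbT.
by apply: row_word_map => //; rewrite yz ?mem_head.
Qed.

End HeckeMorphism.

Section CoxeterLength.
Variable n : nat.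
Implicit Types (w : 'S_n) (i k : 'I_n).

(** Applying s_i to both entries of a pair maps the inversions of w bijectively to those of w s_i
    other than (i, k). *)
Lemma coxeter_length_ascent w i k : is_ascent w i k ->
  coxeter_length (tperm i k * w)%g = (coxeter_length w).+1.
Proof.
move=> /andP[/eqP ek wik]; rewrite /coxeter_length.
set A := [set p | _]; set B := [set p | _ & (w p.2 < w p.1)%N].
pose f (p : 'I_n * 'I_n) := (tperm i k p.1, tperm i k p.2).
have gki : (k < i)%N = false by rewrite ltnNge ek leqnSn.
have gw : (w k < w i)%N = false by rewrite ltnNge ltnW.
have fK : involutive f by case=> a b; rewrite /f /= !tpermK.
have fB p : (p \in f @: B) = (f p \in B).
  by rewrite -{1}[p]fK (mem_imset _ _ (inv_inj fK)).
have -> : A = (i, k) |: f @: B.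
  apply/setP => p; rewrite in_setU1 fB !inE.
  case: p => a b; rewrite /= !permM.
  have [/eqP[-> ->]|nab] /= := boolP ((a, b) == (i, k)).
    by rewrite tpermL tpermR ek leqnn wik.
  have [/eqP[-> ->]|nba] := boolP ((a, b) == (k, i)).
    by rewrite tpermL tpermR gki gw !andbF.
  by rewrite lt_adjacent_tperm.
rewrite cardsU1 card_imset; last exact: inv_inj.
by rewrite fB !inE /= tpermL tpermR gki.
Qed.

Lemma ascent_or_longest w :
  (exists i k, is_ascent w i k) \/ w = longest_perm n.
Proof.
have [/existsP[i /existsP[k a]]|] := boolP [exists i, exists k, is_ascent w i k].
  by left; exists i, k.
move/existsPn => no; right.
have desc (i k : 'I_n) : k = i.+1 :> nat -> (w k < w i)%N.
  move=> e; have /existsPn/(_ k) := no i; rewrite /is_ascent e eqxx /= -leqNgt leq_eqVlt.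
  case/orP => // /eqP/val_inj/perm_inj e'; by rewrite e' in e; lia.
(* Strict decrease bounds w i from above by counting from the first position and from below by
   counting from the last; the bounds meet at n - 1 - i. *)
have up m : forall i : 'I_n, i = m :> nat -> (w i + i <= n.-1)%N.
  elim: m => [|m IH] i e; first by have := ltn_ord (w i); lia.
  have lt : (m < n)%N by have := ltn_ord i; lia.
  have := IH (Ordinal lt) erefl; have := desc (Ordinal lt) i e; rewrite /=; lia.
have down m : forall i : 'I_n, (i + m = n.-1)%N -> (m <= w i)%N.
  elim: m => // m IH i e.
  have lt : (i.+1 < n)%N by lia.
  have := IH (Ordinal lt); have := desc i (Ordinal lt) erefl; rewrite /=; lia.
apply/permP => i; apply/val_inj; rewrite permE /=.
have := up i i erefl; have := down (n.-1 - i)%N i; have := ltn_ord i; lia.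
Qed.

End CoxeterLength.

(** * The Grothendieck recursion *)

Section FominKirillov.
Variable n : nat.
Local Notation poly := {mpoly int[n]}.

(** The variables carry the sign (-1)^|alpha|. *)
Definition neg_var (i : 'I_n) : poly := - 'X_i.

Lemma neg_var_neq0 i : 1 + neg_var i != 0.
Proof.
rewrite /neg_var subr_eq0; apply/eqP => /(congr1 (mcoeff 0%MM)).
by rewrite mcoeff1 eqxx mcoeffX; case: eqP => // /(congr1 mdeg); rewrite mdeg1 mdeg0.
Qed.

(** The extra factor completes row k by the letter i, so rows i and k have the same letters and can
    be exchanged by [row_word_swap]; no other row involves x_i or x_k. *)
Lemma hecke_sum_symmetric (i k : 'I_n) w : k = i.+1 :> nat ->
  let f := hstep i (neg_var k) (hecke_sum neg_var) in
  msym (tperm i k) (f w : poly) = f w.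
Proof.
move=> ek /=; set t := tperm i k.
pose pre := take i (enum 'I_n); pose post := drop k.+1 (enum 'I_n).
have enumE : enum 'I_n = pre ++ i :: k :: post.
  rewrite {1}(enum_ord_split i) -ek; congr (_ ++ _ :: _).
  by rewrite (drop_nth i) ?size_enum_ord // nth_ord_enum.
pose act x y (f : {ffun 'S_n -> poly^o}) := word_act (rows_word neg_var post)
  (word_act (row_word n i x ++ row_word n i y) (word_act (rows_word neg_var pre) f)).
have E : hstep i (neg_var k) (hecke_sum neg_var)
         = act (neg_var i) (neg_var k) (delta n _).
  rewrite /hecke_sum /act enumE rows_word_cat !rows_word_cons catA !word_act_cat.
  (* The rows after k only have letters greater than i + 1, which commute with u_i. *)
  rewrite -rows_word_hstep; last by move=> j; rewrite mem_drop_enum_ord ek.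
  by congr (word_act _ _); rewrite ek -row_word_act.
rewrite E.
have sX j : msym t (neg_var j) = neg_var (t j).
  by rewrite /neg_var msymN msym_tpermX.
have sE j : i != j -> k != j -> msym t (neg_var j) = neg_var j.
  by move=> nij nkj; rewrite sX tpermD.
transitivity (act (neg_var k) (neg_var i) (delta n _) w); last first.
  have e := row_word_swap i (word_act (rows_word neg_var pre) (delta n _))
    (neg_var_neq0 k) (neg_var_neq0 i).
  by rewrite /act; move: e => /= ->.
apply: (rows_word_map (sigma := msym t)) => [j|{}w].
  by rewrite mem_drop_enum_ord => lt; apply: sE; apply/eqP => e; move: lt; rewrite -e; lia.
rewrite !word_act_cat; apply: (row_word_map (sigma := msym t)) => [|{}w].
  by apply: etrans (sX k) _; rewrite tpermR.
apply: (row_word_map (sigma := msym t)) => [|{}w].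
  by apply: etrans (sX i) _; rewrite tpermL.
apply: (rows_word_map (sigma := msym t)) => [j|{}w].
  by rewrite mem_take_enum_ord => lt; apply: sE; apply/eqP => e; move: lt; rewrite -e; lia.
by rewrite !ffunE; apply: rmorph_nat.
Qed.

(** Write H for [hecke_sum] and v = w s_i. At the ascent w, symmetry says that H_w is invariant; at
    v, that H_v - x_k (H_v + H_w) is. The latter invariance, rearranged, is the claim. *)
Lemma hecke_sum_ascent w i k : is_ascent w i k ->
  isobaric_ddiff i k (hecke_sum neg_var (tperm i k * w)%g) = - hecke_sum neg_var w.
Proof.
move=> /andP[/eqP ek wik]; set v := (tperm i k * w)%g; set t := tperm i k.
have nik : i != k by apply/eqP => e; rewrite e in ek; lia.
apply: (mulIf (subX_neq0 nik)); rewrite isobaric_ddiffE.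
have := hecke_sum_symmetric v ek; have := hecke_sum_symmetric w ek; rewrite /=.
rewrite !ffun_addE !ffun_scaleE !ffunE !(rdescE _ ek) (adjE ek) -/t.
rewrite [(w k < w i)%N]ltnNge ltnW //= mulr0 addr0 => symw.
rewrite !permM tpermL tpermR wik mulgA tperm2 mul1g.
rewrite !(msymD, msymM) symw /neg_var msymN msym_tpermX tpermR.
move: (hecke_sum _ w : poly) (hecke_sum _ v : poly) => f g.
move: (msym t g) => h e.
transitivity ((g + - 'X_k * (g + f)) - (h + - 'X_i * (h + f)) + 'X_k * f - 'X_i * f).
  by ring.
by rewrite e; ring.
Qed.

(** Downward induction on the length. The value at the longest permutation is left as a hypothesis,
    since it is read off the fillings in [hecke_sum_longest]. *)
Lemma grothendieck_hecke w :
    hecke_sum neg_var (longest_perm n)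
    = (-1) ^+ coxeter_length (longest_perm n) * staircase_monomial n ->
  grothendieck w = (-1) ^+ coxeter_length w * hecke_sum neg_var w.
Proof.
move=> base; have [m] := ubnP (n * n - coxeter_length w).
elim: m w => // m IH w lem.
have [[i [k asc]]|->] := ascent_or_longest w; last first.
  by rewrite base mulrA -expr2 sqrr_sign mul1r grothendieck_longest.
have /andP[/eqP ek _] := asc.
have nik : i != k by apply/eqP => e; rewrite e in ek; lia.
rewrite (grothendieck_ascent asc) IH; last first.
  rewrite (coxeter_length_ascent asc).
  have : (coxeter_length (tperm i k * w)%g <= n * n)%N.
    by rewrite /coxeter_length (leq_trans (max_card _)) // card_prod card_ord.
  by rewrite (coxeter_length_ascent asc); lia.
apply: (mulIf (subX_neq0 nik)); rewrite isobaric_ddiffE.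
have := isobaric_ddiffE i k (hecke_sum neg_var (tperm i k * w)%g).
rewrite (hecke_sum_ascent asc).
rewrite (coxeter_length_ascent asc) exprS msymM.
have -> : msym (tperm i k) (-1 * (-1) ^+ coxeter_length w : poly)
   = -1 * (-1) ^+ coxeter_length w.
  by rewrite rmorphM rmorphXn /= !rmorphN1.
move: (hecke_sum neg_var _ : poly) => f; move: (hecke_sum neg_var _ : poly) => g.
move: (msym _ g) ((-1) ^+ _) => h c e.
by transitivity (- c * ((1 - 'X_k) * g - (1 - 'X_i) * h)); [ring | rewrite -e; ring].
Qed.

End FominKirillov.

(** * Pipe dreams as Demazure products *)

Section PipeTracing.
Variable n : nat.
Local Notation cell := ('I_n * 'I_n)%type.
Implicit Types (P : {set cell}) (q w : 'S_n) (c : cell) (s : seq cell).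

Definition demazure_step P q c : 'S_n :=
  if (c \in P) && ~~ rdesc (c.1 + c.2) q then (adj n (c.1 + c.2) * q)%g else q.

Definition demazure P s : 'S_n := foldl (demazure_step P) 1%g s.

(* The pipes met along the frontier of the tiles already traced, from its     *)
(* south-west end to its north-east end, are q 0, q 1, ..., when the first m  *)
(* tiles of row i are still to be traced.                                     *)
Definition frontier (i m : nat) q (t : trace_state n) : Prop :=
  [/\ forall i' : 'I_n, (i' < i)%N -> left_pipe t i' = q i',
      forall j k : 'I_n, (j < m)%N -> k = i + j :> nat -> down_pipe t j = q k,
      forall i' k : 'I_n, i' = i :> nat -> k = i + m :> nat -> left_pipe t i' = q k,
      forall j k : 'I_n, (m <= j)%N -> k = (i + j).+1 :> nat -> down_pipe t j = q k
    & forall a b : 'I_n, (a < b)%N -> ([set q a; q b] \in crossed t) = (q b < q a)%N].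

Lemma frontier_row i q t : frontier i 0 q t -> frontier i.+1 n q t.
Proof.
case=> h1 h2 h3 h4 h5; split=> //.
- move=> i'; rewrite ltnS leq_eqVlt => /orP[/eqP e|]; last exact: h1.
  by apply: h3; lia.
- by move=> j k _ e; apply: h4 => //; rewrite e addSn.
- by move=> i' k _ e; have := ltn_ord k; lia.
- by move=> j k; have := ltn_ord j; lia.
Qed.

(** The pipes meeting at tile (i, j) occupy the positions i + j and i + j + 1 of the frontier, and
    have crossed already exactly when q has a descent there. Ignoring second crossings is thus the
    Demazure product. *)
Lemma frontier_tile P i m q t (i0 j0 : 'I_n) : i0 = i :> nat -> j0 = m :> nat ->
  frontier i m.+1 q t ->
  frontier i m (demazure_step P q (i0, j0)) (trace_tile P t (i0, j0)).
Proof.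
move=> ei ej [h1 h2 h3 h4 h5]; rewrite /trace_tile; case: t h1 h2 h3 h4 h5 => d l X /=.
move=> h1 h2 h3 h4 h5.
(* On and below the antidiagonal the letter is at least n - 1, where [adj] is the identity. *)
have out : (n <= (i0 + j0).+1)%N -> demazure_step P q (i0, j0) = q.
  by move=> le; rewrite /demazure_step adj_out // mul1g if_same.
case: ltnP => [lt|le]; first rewrite out; try lia.
  split=> //=; first by move=> j k ltj; apply: h2; lia.
  - by move=> i' k _ e; have := ltn_ord k; lia.
  - by move=> j k lej e; have := ltn_ord k; lia.
case: eqP => [e|ne]; first rewrite out; try lia.
  split=> //=.
  - by move=> i' lti; rewrite ffunE -(inj_eq val_inj) /= ltn_eqF ?ei //; apply: h1.
  - by move=> j k ltj; apply: h2; lia.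
  - move=> i' k ei' ek; rewrite ffunE -(inj_eq val_inj) /= ei' ei eqxx.
    by apply: h2; lia.
  - by move=> j k lej ek; have := ltn_ord k; lia.
have lt1 : (i0 + j0 < n)%N by lia.
have lt2 : ((i0 + j0).+1 < n)%N by lia.
pose k1 := Ordinal lt1; pose k2 := Ordinal lt2.
have dj : d j0 = q k1 by apply: h2; rewrite /=; lia.
have li : l i0 = q k2 by apply: h3; rewrite /=; lia.
rewrite dj li h5 //= /demazure_step /= -[(i0 + j0)%N]/(nat_of_ord k1).
rewrite (@rdescE _ k1 k2) // (@adjE _ k1 k2) //.
case: ifP => [/andP[cP asc]|_]; last first.
  split=> //=.
  - by move=> i' lti; rewrite ffunE -(inj_eq val_inj) /= ltn_eqF ?ei //; apply: h1.
  - move=> j k ltj ek; rewrite ffunE -(inj_eq val_inj) /= ltn_eqF ?ej //; apply: h2; lia.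
  - move=> i' k ei' ek; rewrite ffunE -(inj_eq val_inj) /= ei' ei eqxx.
    by congr (q _); apply/val_inj => /=; lia.
  - move=> j k lej ek; rewrite ffunE; case: eqP => [ejj|njj].
      by congr (q _); apply/val_inj => /=; rewrite ek ejj; lia.
    apply: h4 => //; rewrite ltn_neqAle lej andbT; apply/eqP => e; apply: njj.
    by apply/val_inj; rewrite /= ej.
have ne12 (k : 'I_n) (j : nat) : k = j :> nat -> j != (i0 + j0)%N -> j != (i0 + j0).+1 ->
    (tperm k1 k2 * q)%g k = q k.
  move=> <- n1 n2; rewrite permM tpermD //; apply/eqP => e; [move/eqP: n1|move/eqP: n2];
    by rewrite -e.
split=> //=.
- move=> i' lti; rewrite (@ne12 _ i') //; [exact: h1|lia|lia].
- by move=> j k ltj ek; rewrite (@ne12 _ (i + j)) //; [apply: h2; lia|lia|lia].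
- move=> i' k ei' ek; have -> : i' = i0 by apply/val_inj; rewrite /= ei'.
  have -> : k = k1 by apply/val_inj => /=; lia.
  by rewrite li permM tpermL.
- move=> j k lej ek; have [ejj|njj] := eqVneq j j0.
    have -> : k = k2 by apply/val_inj => /=; rewrite ek ejj; lia.
    by rewrite permM tpermR ejj.
  have ltj : (m < j)%N.
    rewrite ltn_neqAle lej andbT -ej eq_sym; exact: njj.
  by rewrite (@ne12 _ (i + j).+1) //; [apply: h4 | lia | lia].
move=> a b ltab; rewrite !permM !inE.
have [/eqP[-> ->]|nab] := boolP ((a, b) == (k1, k2)).
  rewrite tpermL tpermR setUC eqxx /=.
  by rewrite ltn_neqAle leqNgt asc andbT val_eqE (inj_eq (@perm_inj _ q)) -val_eqE /= ltn_eqF.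
have nba : (a, b) != (k2, k1).
  by apply: contraL ltab => /eqP[-> ->]; rewrite -leqNgt /=.
have ltt : (tperm k1 k2 a < tperm k1 k2 b)%N by rewrite lt_adjacent_tperm.
(* Only the positions k1 and k2 can give the newly crossed pair. *)
rewrite h5 //; case: eqP => //= e; exfalso.
have m1 : q (tperm k1 k2 a) \in [set q k1; q k2] by rewrite -e !inE eqxx.
have m2 : q (tperm k1 k2 b) \in [set q k1; q k2] by rewrite -e !inE eqxx orbT.
move: m1 m2; rewrite !inE !(inj_eq (@perm_inj _ q)) => m1 m2.
have tE x y : (tperm k1 k2 x == y) = (x == tperm k1 k2 y).
  by rewrite -(inj_eq (@perm_inj _ (tperm k1 k2))) tpermK.
rewrite !tE tpermL tpermR in m1 m2; move: nab nba ltab; rewrite !xpair_eqE.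
by case/orP: m1 => /eqP->; case/orP: m2 => /eqP->; rewrite ?eqxx ?ltnn.
Qed.

Lemma frontier_row_tiles P (i : 'I_n) m q t : (m <= n)%N -> frontier i m q t ->
  let s := [seq (i, j) | j <- rev (take m (enum 'I_n))] in
  frontier i 0 (foldl (demazure_step P) q s) (foldl (trace_tile P) t s).
Proof.
elim: m q t => [|m IH] q t lem h; first by rewrite take0.
rewrite /= (take_nth i) ?size_enum_ord // rev_rcons /=.
apply: IH; first exact: ltnW.
by apply: frontier_tile h; rewrite // nth_enum_ord.
Qed.

Lemma trace_pipesE P (i : 'I_n) : left_pipe (trace_pipes P) i = demazure P (trace_order n) i.
Proof.
pose cells r := [seq (i, j) | i <- drop r (enum 'I_n), j <- rev (enum 'I_n)].
have rows d r q t : (r + d = n)%N -> frontier r n q t ->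
    frontier n n (foldl (demazure_step P) q (cells r)) (foldl (trace_tile P) t (cells r)).
  elim: d r q t => [|d IH] r q t er h.
    by rewrite addn0 in er; rewrite /cells er drop_oversize ?size_enum_ord //= -{1}er.
  have lt : (r < n)%N by lia.
  rewrite /cells (drop_nth (Ordinal lt)) ?size_enum_ord //.
  rewrite (nth_ord_enum (Ordinal lt) (Ordinal lt)) allpairs_cons !foldl_cat.
  apply: IH; first by lia.
  apply: frontier_row.
  have := @frontier_row_tiles P (Ordinal lt) n q t (leqnn n) h.
  by rewrite take_oversize ?size_enum_ord.
have h0 : frontier 0 n 1%g (TraceState [ffun j => j] [ffun i => i] set0).
  split=> //=; first by move=> j k _ e; rewrite ffunE perm1; apply/val_inj.
  - by move=> i' k _ e; have := ltn_ord k; lia.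
  - by move=> j k lej e; have := ltn_ord j; lia.
  - by move=> a b lt; rewrite inE !perm1 ltnNge ltnW.
have [+ _ _ _ _] := rows n 0 _ _ erefl h0.
by move=> /(_ i (ltn_ord i)); rewrite /cells drop0.
Qed.

End PipeTracing.

(** * Generating function of pipe dreams *)

Section PipeDreamSum.
Variables (n : nat) (R : comNzRingType) (y : 'I_n -> R).
Local Notation cell := ('I_n * 'I_n)%type.
Implicit Types (P : {set cell}) (q w : 'S_n) (c : cell) (s : seq cell).

Lemma rdesc_adj b q : (b.+1 < n)%N -> rdesc b (adj n b * q)%g = ~~ rdesc b q.
Proof.
case: (adjP n b) => [i k -> ek _|le]; last by lia.
rewrite !(rdescE _ ek) (adjE ek) !permM tpermL tpermR -leqNgt [RHS]leq_eqVlt.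
by rewrite (inj_eq val_inj) (inj_eq (@perm_inj _ q)) (negbTE (adj_nat ek)).
Qed.

(** [hecke] is the transpose of Demazure multiplication: w has the preimages w and w s_b if b is a
    descent of w, and none otherwise. *)
Lemma demazure_mul_eq b q w : (b.+1 < n)%N ->
  ((if ~~ rdesc b q then adj n b * q else q)%g == w)%:R
  = (if rdesc b w then (q == w)%:R + (q == adj n b * w)%g%:R else 0) :> R.
Proof.
move=> lt; have adjw x : (adj n b * x == w)%g = (x == adj n b * w)%g.
  by rewrite -(inj_eq (mulgI (adj n b))) mulgA adjK mul1g.
have nw : (w == adj n b * w)%g = false.
  by apply/eqP => e; have := rdesc_adj w lt; rewrite -e; case: rdesc.
case dq : (rdesc b q) => /=.
  have [e|nqw] := eqVneq q w; first by rewrite e in dq *; rewrite dq nw addr0.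
  case: ifP => // dw; case: eqP => [e|_]; last by rewrite addr0.
  by rewrite e rdesc_adj // dw in dq.
rewrite adjw; have [e|nqw] := eqVneq q (adj n b * w)%g.
  by move: dq; rewrite e rdesc_adj // eq_sym nw add0r; case: rdesc.
case: ifP => // dw; case: eqP => [e|_]; last by rewrite addr0.
by rewrite e dw in dq.
Qed.

Definition region s : {set cell} := [set c in s | (c.1.+1 + c.2.+1 <= n)%N].

Lemma sum_subset_setU1 c (A : {set cell}) (F : {set cell} -> R) : c \notin A ->
  \sum_(P : {set cell} | P \subset c |: A) F P = \sum_(P : {set cell} | P \subset A) (F P + F (c |: P)).
Proof.
move=> cA; rewrite (bigID (fun P : {set cell} => c \in P)) /= addrC big_split /=; congr (_ + _).
  apply: eq_bigl => P; apply/andP/idP => [[PA cP]|PA].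
    by apply/subsetP => x xP; have := subsetP PA x xP; rewrite !inE; case: eqP => // e; rewrite -e xP in cP.
  split; first exact: subset_trans PA (subsetUr _ _).
  by apply: contra cA; apply: (subsetP PA).
rewrite (reindex_onto (fun P : {set cell} => c |: P) (fun P => P :\ c)) /=.
  apply: eq_bigl => P; rewrite setU11 andbT.
  apply/andP/idP => [[PA /eqP e]|PA].
    apply/subsetP => x xP; have := subsetP PA x; rewrite !inE xP orbT => /(_ isT).
    case: eqP => // ex; rewrite ex -e !inE eqxx in xP.
    by [].
  split; first exact: setUS.
  rewrite setU1K //; by apply: contra cA; apply: (subsetP PA).
by move=> P /andP[_ cP]; rewrite setD1K.
Qed.

Lemma demazure_setU1 c P s : c \notin s -> demazure (c |: P) s = demazure P s.
Proof.
rewrite /demazure; elim: s (1%g : 'S_n) => //= d s IH q; rewrite inE negb_or => /andP[ncd cs].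
by rewrite IH // /demazure_step !inE eq_sym (negbTE ncd).
Qed.

(** The factor 1 + y u of a tile expands into the choice between a bump and a crossing. *)
Lemma demazure_sum s w : uniq s ->
  \sum_(P : {set cell} | P \subset region s) (\prod_(c in P) y c.1) * (demazure P s == w)%:R
  = word_act [seq ((c.1 + c.2)%N, y c.1) | c : cell <- s] (delta n R) w.
Proof.
elim/last_ind: s w => [|s c IH] w.
  move=> _; rewrite (eq_bigl (pred1 set0)) => [|P].
    by rewrite big_pred1_eq big_set0 mul1r /= ffunE eq_sym.
  have -> : region [::] = set0 by apply/setP => c; rewrite !inE.
  by rewrite subset0.
rewrite rcons_uniq => /andP[cs us].
rewrite map_rcons /word_act foldl_rcons -/(word_act _ _) -cats1 /=.
have stepE P : demazure P (s ++ [:: c]) = demazure_step P (demazure P s) c.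
  by rewrite /demazure foldl_cat.
have [le|lt] := leqP n (c.1 + c.2).+1.
  have -> : region (s ++ [:: c]) = region s.
    apply/setP => d; rewrite !inE mem_cat inE.
    by case: eqP => [->|_]; rewrite ?orbF // orbT addnS addSn ltnNge le /= andbF.
  rewrite hstep_out // -IH //; apply: eq_bigr => P _.
  by rewrite stepE /demazure_step adj_out // mul1g if_same.
have cr : c \notin region s by rewrite inE (negbTE cs).
have -> : region (s ++ [:: c]) = c |: region s.
  apply/setP => d; rewrite !inE mem_cat inE andb_orl orbC; congr (_ || _).
  by case: eqP => // ->; rewrite addnS addSn lt.
rewrite sum_subset_setU1 // ffun_addE ffun_scaleE ffunE -!IH //.
rewrite big_split /=; congr (_ + _).
  apply: eq_bigr => P PA; rewrite stepE /demazure_step.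
  by rewrite (negbTE (contra (subsetP PA c) cr)).
transitivity (\sum_(P : {set cell} | P \subset region s) y c.1 * ((\prod_(c in P) y c.1) *
    (if rdesc (c.1 + c.2) w then (demazure P s == w)%:R
       + (demazure P s == adj n (c.1 + c.2) * w)%g%:R else 0))).
  apply: eq_bigr => P PA; rewrite stepE demazure_setU1 //.
  rewrite big_setU1 ?(contra (subsetP PA c)) // -mulrA; congr (_ * (_ * _)).
  by rewrite -demazure_mul_eq // /demazure_step setU11.
rewrite -mulr_sumr; congr (_ * _); case: ifP => _.
  by rewrite -big_split; apply: eq_bigr => P _; rewrite mulrDr.
by rewrite big1 // => P _; rewrite mulr0.
Qed.

Lemma word_act_trace_order (f : {ffun 'S_n -> R^o}) :
  word_act [seq ((c.1 + c.2)%N, y c.1) | c : cell <- trace_order n] f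
  = word_act (rows_word y (enum 'I_n)) f.
Proof.
have [r er] : exists r, r = rev (enum 'I_n) by eexists.
rewrite /trace_order -er; elim: (enum 'I_n) f => // i s IH f.
rewrite allpairs_cons map_cat rows_word_cons !word_act_cat IH; congr (word_act _ _).
have -> : [seq ((c.1 + c.2)%N, y c.1) | c : cell <- [seq (i, j) | j <- r]]
    = [seq (b, y i) | b <- rev (iota i n)].
  have -> : iota i n = [seq (i + j)%N | j <- iota 0 n] by rewrite -iotaDl addn0.
  by rewrite er -val_enum_ord -2!map_rev -!map_comp.
(* The tracing visits whole rows; the last i + 1 letters are at least n - 1 and act trivially. *)
have -> : iota i n = iota i (n.-1 - i + i.+1)%N.
  by congr iota; have := ltn_ord i; lia.
rewrite iotaD rev_cat map_cat word_act_cat; congr (word_act _ _).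
have : all (fun b => n <= b.+1)%N (rev (iota (i + (n.-1 - i)) i.+1)).
  by apply/allP => b; rewrite mem_rev mem_iota; have := ltn_ord i; lia.
by elim: (rev _) => //= b t IHt /andP[le /IHt]; rewrite hstep_out.
Qed.

Lemma PD_sum w :
  \sum_(P in PD w) \prod_(c in P) y c.1 = hecke_sum y w.
Proof.
have ut : uniq (trace_order n).
  by apply: allpairs_uniq; rewrite ?rev_uniq ?enum_uniq // => -[a b] [a' b'].
have -> : hecke_sum y w
    = word_act [seq ((c.1 + c.2)%N, y c.1) | c : cell <- trace_order n] (delta n R) w.
  by rewrite word_act_trace_order.
rewrite -demazure_sum // big_mkcond [RHS]big_mkcond /=; apply: eq_bigr => P _.
rewrite inE; have -> : is_pipe_dream P = (P \subset region (trace_order n)).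
  apply/forallP/subsetP => [h c cP|h c]; last first.
    by apply/implyP => /h; rewrite inE => /andP[].
  rewrite inE (implyP (h c) cP) andbT; case: c {cP} => i j.
  by apply/allpairsP; exists (i, j); rewrite mem_rev !mem_enum.
have -> : [forall i, left_pipe (trace_pipes P) i == w i] = (demazure P (trace_order n) == w).
  apply/forallP/eqP => [h|<- i]; last by rewrite trace_pipesE.
  by apply/permP => i; rewrite -trace_pipesE; apply/eqP.
by case: (P \subset _) => //=; case: eqP => _; rewrite (mulr1, mulr0).
Qed.

End PipeDreamSum.

(** * The generating function of fillings *)

Section Fillings.
Variable n : nat.
Local Notation cell := ('I_n * 'I_n)%type.
Local Notation filling := {ffun cell -> {set 'I_n}}.
Implicit Types (w : 'S_n) (i j k l x : 'I_n) (r m : nat) (T : filling).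

Definition inversion w i k : bool := (i < k)%N && (w k < w i)%N.

(* T (i, k) is the set of rows occupied by the box of the Rothe diagram in    *)
(* row i and column w k, together with its ghosts.  The bounds r and m freeze *)
(* the part of a pipe dream that has already been removed: rows < r are empty *)
(* and row r only has entries in columns < m.                                 *)
Definition valid r m w T : bool :=
  [&& [forall c : cell, (T c != set0) == inversion w c.1 c.2],
      [forall c : cell, forall x in T c,
         [&& r <= x, x <= c.1 & (x == r :> nat) ==> (w c.2 < m)]%N],
      [forall i : 'I_n, forall k : 'I_n, forall k' : 'I_n, (w k < w k')%N ==>
        [forall x in T (i, k), forall x' in T (i, k'), x' <= x]%N] &
      [forall k : 'I_n, forall i : 'I_n, forall i' : 'I_n, (i < i')%N ==>
        [forall x in T (i, k), forall x' in T (i', k), x < x']%N]].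

Record valid_spec r m w T : Prop := ValidSpec {
  valid_inv : forall i k, (T (i, k) != set0) = inversion w i k;
  valid_ge : forall i k x, x \in T (i, k) -> (r <= x)%N;
  valid_le : forall i k x, x \in T (i, k) -> (x <= i)%N;
  valid_lt : forall i k x, x \in T (i, k) -> x = r :> nat -> (w k < m)%N;
  valid_row : forall i k k' x x', (w k < w k')%N -> x \in T (i, k) -> x' \in T (i, k') -> (x' <= x)%N;
  valid_col : forall i i' k x x', (i < i')%N -> x \in T (i, k) -> x' \in T (i', k) -> (x < x')%N }.

Lemma validP r m w T : reflect (valid_spec r m w T) (valid r m w T).
Proof.
apply: (iffP and4P) => [[/forallP h1 /forallP h2 /forallP h3 /forallP h4]|[h1 h2 h3 h4 h5 h6]].
  split.
  - by move=> i k; apply/eqP: (h1 (i, k)).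
  - by move=> i k x xT; have /forallP/(_ x)/implyP/(_ xT)/and3P[] := h2 (i, k).
  - by move=> i k x xT; have /forallP/(_ x)/implyP/(_ xT)/and3P[] := h2 (i, k).
  - move=> i k x xT e; have /forallP/(_ x)/implyP/(_ xT)/and3P[_ _] := h2 (i, k).
    by rewrite e eqxx.
  - move=> i k k' x x' lt xT xT'; have /forallP/(_ k)/forallP/(_ k')/implyP/(_ lt) := h3 i.
    by move=> /forallP/(_ x)/implyP/(_ xT)/forallP/(_ x')/implyP/(_ xT').
  - move=> i i' k x x' lt xT xT'; have /forallP/(_ i)/forallP/(_ i')/implyP/(_ lt) := h4 k.
    by move=> /forallP/(_ x)/implyP/(_ xT)/forallP/(_ x')/implyP/(_ xT').
split.
- by apply/forallP => -[i k]; apply/eqP.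
- apply/forallP => -[i k]; apply/forallP => x; apply/implyP => xT.
  by rewrite (h2 _ _ _ xT) (h3 _ _ _ xT); apply/implyP => /eqP; apply: h4 xT.
- apply/forallP => i; apply/forallP => k; apply/forallP => k'; apply/implyP => lt.
  apply/forallP => x; apply/implyP => xT; apply/forallP => x'; apply/implyP => xT'.
  exact: h5 xT xT'.
- apply/forallP => k; apply/forallP => i; apply/forallP => i'; apply/implyP => lt.
  apply/forallP => x; apply/implyP => xT; apply/forallP => x'; apply/implyP => xT'.
  exact: h6 xT xT'.
Qed.

Lemma valid_mem r m w T i k : valid_spec r m w T -> inversion w i k -> exists x, x \in T (i, k).
Proof. by move=> v; rewrite -(valid_inv v) => /set0Pn. Qed.

Lemma valid_mem_inv r m w T i k x : valid_spec r m w T -> x \in T (i, k) -> inversion w i k.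
Proof. by move=> v xT; rewrite -(valid_inv v); apply/set0Pn; exists x. Qed.

Lemma inversion_adj (B B1 : 'I_n) w i k (c := (w^-1)%g B1) (d := (w^-1)%g B) :
    B1 = B.+1 :> nat -> (c < d)%N ->
  inversion (w * tperm B B1)%g i k = inversion w i k && ((i, k) != (c, d)).
Proof.
move=> eB ltcd; have wc : w c = B1 by rewrite permKV.
have wd : w d = B by rewrite permKV.
rewrite /inversion !permM; have [/eqP[-> ->]|ncd] := boolP (_ == _).
  by rewrite wc wd tpermL tpermR andbF eB [(B.+1 < B)%N]ltnNge leqnSn andbF.
rewrite andbT; have [/eqP[-> ->]|ndc] := boolP ((i, k) == (d, c)).
  by rewrite [(d < c)%N]ltnNge ltnW.
rewrite lt_adjacent_tperm //.
  by apply: contra ncd; rewrite !xpair_eqE -wd -wc !(inj_eq (@perm_inj _ w)) andbC.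
by apply: contra ndc; rewrite !xpair_eqE -wd -wc !(inj_eq (@perm_inj _ w)) andbC.
Qed.

Definition update T c (S : {set 'I_n}) : filling := [ffun p => if p == c then S else T p].

(** * Removing one entry of a filling *)

Section Step.
Variables (r B B1 : 'I_n) (w : 'S_n).
Hypotheses (eB : B1 = B.+1 :> nat) (lerB : (r <= B)%N).
Let c := (w^-1)%g B1.
Let d := (w^-1)%g B.
Let wc : w c = B1. Proof. by rewrite permKV. Qed.
Let wd : w d = B. Proof. by rewrite permKV. Qed.

Let eq_c i : w i = B.+1 :> nat -> i = c.
Proof. by move=> e; apply: (@perm_inj _ w); rewrite wc; apply/val_inj; rewrite /= e. Qed.
Let eq_d i : w i = B :> nat -> i = d.
Proof. by move=> e; apply: (@perm_inj _ w); rewrite wd; apply/val_inj. Qed.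

(** Only the cell (c, d) can contain r in column B. Below row c, strictness would force a smaller
    entry in (c, d); above it, the row would need an entry r in the column B + 1, where r is
    forbidden. *)
Lemma valid_step_notin T : valid r B.+1 w T && (r \notin T (c, d)) = valid r B w T.
Proof.
apply/andP/idP => [[/validP v nr]|/validP v]; last first.
  split; last by apply/negP => /(valid_lt v)/(_ erefl); rewrite wd ltnn.
  apply/validP; case: v => h1 h2 h3 h4 h5 h6; split=> // i k x xT ex.
  by rewrite ltnS ltnW // (h4 i k x).
apply/validP; split; [exact: valid_inv v|exact: valid_ge v|exact: valid_le v| |
  exact: valid_row v|exact: valid_col v].
move=> i k x xT ex; have exr : x = r by apply/val_inj.
subst x; have := valid_lt v xT ex; rewrite ltnS leq_eqVlt => /orP[/eqP/eq_d ek|//].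
subst k; have /andP[ltid ltw] := valid_mem_inv v xT.
have [eic|nic] := eqVneq i c; first by subst i; rewrite xT in nr.
have lt1 : (B1 < w i)%N.
  rewrite ltn_neqAle eB -{2}wd ltw andbT; apply: contra nic => /eqP e.
  by rewrite (@eq_c i).
have [ltci|lei] := ltnP c i.
  have [|z zT] := @valid_mem _ _ _ _ c d v.
    by rewrite /inversion wc wd eB ltnSn (ltn_trans ltci).
  by have := valid_col v ltci zT xT; rewrite ltnNge (valid_ge v zT).
have ltic : (i < c)%N by rewrite ltn_neqAle lei andbT val_eqE.
have [|z zT] := @valid_mem _ _ _ _ i c v; first by rewrite /inversion ltic wc.
have wdc : (w d < w c)%N by rewrite wd wc eB.
have ez : z = r :> nat.
  by apply/eqP; rewrite eqn_leq (valid_ge v zT) (valid_row v wdc xT zT).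
by have := valid_lt v zT ez; rewrite wc eB ltnn.
Qed.

Hypotheses (ltcd : (c < d)%N) (lerc : (r <= c)%N).
Hypothesis top : forall i, (i < c)%N -> (w i <= B1)%N.

Let inv_cd : inversion w c d. Proof. by rewrite /inversion ltcd wc wd eB leqnn. Qed.

Let r_outside T i k : valid_spec r B.+1 w T -> r \in T (c, d) -> (i, k) != (c, d) ->
  r \in T (i, k) -> (w k < B)%N.
Proof.
move=> v rcd nik rT; have := valid_lt v rT erefl; rewrite ltnS leq_eqVlt.
case/orP=> // /eqP/eq_d e; subst k; have [ltic|ltci|/val_inj e] := ltngtP i c.
- by have := valid_col v ltic rT rcd; rewrite ltnn.
- by have := valid_col v ltci rcd rT; rewrite ltnn.
- by rewrite e eqxx in nik.
Qed.

Lemma valid_step_remove T : valid r B.+1 w T -> r \in T (c, d) -> T (c, d) != [set r] ->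
  valid r B w (update T (c, d) (T (c, d) :\ r)).
Proof.
move=> /validP v rcd nr; set T' := update _ _ _.
have sub p x : x \in T' p -> x \in T p.
  by rewrite ffunE; case: eqP => // ->; rewrite !inE => /andP[].
apply/validP; split.
- move=> i k; rewrite -(valid_inv v) ffunE; case: ifP => [/eqP[-> ->]|//].
  have -> : T (c, d) != set0 by apply/set0Pn; exists r.
  by apply: contra nr => /eqP e; rewrite -(setD1K rcd) e setU0.
- by move=> i k x /sub; apply: (valid_ge v).
- by move=> i k x /sub; apply: (valid_le v).
- move=> i k x xT ex; have exr : x = r by apply/val_inj.
  subst x; apply: (r_outside v rcd) (sub _ _ xT).
  by apply: contraTneq xT => ->; rewrite ffunE eqxx !inE eqxx.
- by move=> i k k' x x' lt /sub xT /sub; apply: (valid_row v lt xT).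
- by move=> i i' k x x' lt /sub xT /sub; apply: (valid_col v lt xT).
Qed.

Let above i : (i < c)%N -> ~~ inversion w i d.
Proof.
move=> ltic; rewrite /inversion wd negb_and -!leqNgt; apply/orP; right.
have := top ltic; rewrite leq_eqVlt => /orP[/eqP|]; last by rewrite eB ltnS.
by rewrite eB => /eq_c e; rewrite e ltnn in ltic.
Qed.

(** The cell (c, d) is at the top of its column by [above] and at the right end of its row since w c
    = B + 1. All other entries are at least r, and r was excluded from column B. *)
Lemma valid_step_add T : valid r B w T -> valid r B.+1 w (update T (c, d) (r |: T (c, d))).
Proof.
move=> /validP v; set T' := update _ _ _.
have memT' i k x : x \in T' (i, k) -> x \in T (i, k) \/ [/\ i = c, k = d & x = r].
  rewrite ffunE; case: eqP => [[-> ->]|_]; last by left.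
  by rewrite !inE => /orP[/eqP->|]; [right | left].
apply/validP; split.
- move=> i k; rewrite -(valid_inv v) ffunE; case: ifP => [/eqP[-> ->]|//].
  rewrite (valid_inv v) inv_cd; by apply/set0Pn; exists r; rewrite !inE eqxx.
- by move=> i k x /memT'[/(valid_ge v)//|[_ _ ->]].
- by move=> i k x /memT'[/(valid_le v)//|[-> _ ->]].
- move=> i k x /memT'[xT ex|[_ -> _] _]; last by rewrite wd.
  by rewrite ltnS ltnW // (valid_lt v xT ex).
- move=> i k k' x x' lt /memT' h /memT' h'; case: h' => [xT'|[_ _ ->]].
    case: h => [xT|[ei ek ->]]; first exact: (valid_row v lt xT xT').
    subst i k; have /andP[ltc ltw] := valid_mem_inv v xT'.
    by move: lt ltw; rewrite wc wd eB; lia.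
  case: h => [xT|[_ _ ->] //]; exact: (valid_ge v xT).
- move=> i i' k x x' lt /memT' h /memT' h'; case: h => [xT|[ei ek ->]].
    case: h' => [xT'|[ei ek _]]; first exact: (valid_col v lt xT xT').
    subst i' k; by have := above lt; rewrite (valid_mem_inv v xT).
  subst i k; case: h' => [xT'|[ei' _ _]]; last by rewrite ei' ltnn in lt.
  rewrite ltn_neqAle (valid_ge v xT') andbT; apply/eqP => e.
  by have := valid_lt v xT' (esym e); rewrite wd ltnn.
Qed.

Let w' := (w * tperm B B1)%g.
Let w'c : w' c = B. Proof. by rewrite permM wc tpermR. Qed.
Let w'd : w' d = B1. Proof. by rewrite permM wd tpermL. Qed.
Let w'E k : k != c -> k != d -> w' k = w k.
Proof.
move=> nc nd; rewrite permM tpermD //; apply/eqP => e.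
  by rewrite (eq_d (esym (congr1 val e))) eqxx in nd.
by rewrite (@eq_c k) ?eqxx // in nc; rewrite -eB e.
Qed.

(** Exchanging the values B and B + 1 deletes exactly the inversion (c, d). Cells are indexed by
    positions, so the other entries stay while the columns B and B + 1 change places. *)
Lemma valid_step_swap_remove T : valid r B.+1 w T -> T (c, d) = [set r] ->
  valid r B w' (update T (c, d) set0).
Proof.
move=> /validP v ecd; have rcd : r \in T (c, d) by rewrite ecd inE.
set T' := update _ _ _.
have sub i k x : x \in T' (i, k) -> x \in T (i, k) /\ (i, k) != (c, d).
  by rewrite ffunE; case: eqP => //; rewrite inE.
apply/validP; split.
- move=> i k; rewrite inversion_adj // -(valid_inv v) ffunE; case: ifP => /= _; first by rewrite eqxx andbF.
  by rewrite andbT.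
- by move=> i k x /sub[+ _]; apply: (valid_ge v).
- by move=> i k x /sub[+ _]; apply: (valid_le v).
- move=> i k x /sub[xT nik] ex; have exr : x = r by apply/val_inj.
  subst x; have ltk := r_outside v rcd nik xT.
  have nkc : k != c by apply: contraTneq ltk => ->; rewrite wc eB; lia.
  have nkd : k != d by apply: contraTneq ltk => ->; rewrite wd; lia.
  by rewrite w'E.
- move=> i k k' x x' lt /sub[xT nik] /sub[xT' nik'].
  (* A row meeting both exchanged columns lies above c, where column d would need an entry smaller
     than r. *)
  have [e|nk] := boolP ((w k, w k') == (B1, B)).
    have [ek ek'] : k = c /\ k' = d.
      by case/eqP: e => ek ek'; split; apply: (@perm_inj _ w); rewrite (wc, wd).
    subst k k'; have /andP[ltic _] := valid_mem_inv v xT.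
    have := valid_col v ltic xT' rcd; by have := valid_ge v xT'; lia.
  apply: (valid_row v) xT xT'; rewrite -(lt_adjacent_tperm eB (p := w k)) -?permM //.
  apply/eqP => -[ek ek']; move: lt; rewrite !permM ek ek' tpermL tpermR eB; lia.
- by move=> i i' k x x' lt /sub[xT _] /sub[xT' _]; apply: (valid_col v lt xT xT').
Qed.

Lemma valid_step_swap_add T : valid r B w' T -> valid r B.+1 w (update T (c, d) [set r]).
Proof.
move=> /validP v; set T' := update _ _ _.
have memT' i k x : x \in T' (i, k) ->
    (x \in T (i, k) /\ (i, k) != (c, d)) \/ [/\ i = c, k = d & x = r].
  rewrite ffunE; case: eqP => [[-> ->]|_]; last by left.
  by rewrite !inE => /eqP->; right.
have invT i k x : x \in T (i, k) -> inversion w i k.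
  by move/(valid_mem_inv v); rewrite inversion_adj // => /andP[].
apply/validP; split.
- move=> i k; rewrite ffunE; case: ifPn => [/eqP[-> ->]|nik].
    by rewrite inv_cd; apply/set0Pn; exists r; rewrite inE.
  by rewrite (valid_inv v) inversion_adj // nik andbT.
- by move=> i k x /memT'[[/(valid_ge v)]//|[_ _ ->]].
- by move=> i k x /memT'[[/(valid_le v)]//|[-> _ ->]].
- move=> i k x /memT'[[xT nik] ex|[_ -> _] _]; last by rewrite wd.
  have := valid_lt v xT ex.
  have [->|nkc] := eqVneq k c; first by rewrite w'c ltnn.
  have [->|nkd] := eqVneq k d; first by rewrite wd.
  by rewrite w'E //; lia.
- move=> i k k' x x' lt /memT' h /memT' h'; case: h' => [[xT' _]|[_ _ ->]].
    case: h => [[xT _]|[ei ek ->]].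
      (* This pair is vacuous: a cell of column c lies above row c, where [above] excludes cells of
         column d. *)
      have [/eqP[ek ek']|nk] := boolP ((w k, w k') == (B, B1)).
        have e : k = d by apply: (@perm_inj _ w); rewrite wd.
        have e' : k' = c by apply: (@perm_inj _ w); rewrite wc.
        subst k k'; have /andP[/above + _] := invT _ _ _ xT'.
        by rewrite (invT _ _ _ xT).
      apply: (valid_row v) xT xT'; rewrite !permM lt_adjacent_tperm //.
      by apply: contraTneq lt => -[-> ->]; rewrite eB; lia.
    subst i k; have /andP[ltc ltw] := invT _ _ _ xT'.
    by move: lt ltw; rewrite wc wd eB; lia.
  case: h => [[xT _]|[_ _ ->] //]; exact: (valid_ge v xT).
- move=> i i' k x x' lt /memT' h /memT' h'; case: h => [[xT _]|[ei ek ->]].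
    case: h' => [[xT' _]|[ei ek _]]; first exact: (valid_col v lt xT xT').
    subst i' k; by have := above lt; rewrite (invT _ _ _ xT).
  subst i k; case: h' => [[xT' _]|[ei' _ _]]; last by rewrite ei' ltnn in lt.
  rewrite ltn_neqAle (valid_ge v xT') andbT; apply/eqP => e.
  by have := valid_lt v xT' (esym e); rewrite w'd eB; lia.
Qed.

End Step.

Definition fixes r m w : bool :=
  [forall i : 'I_n, ((i < r) ==> (w i == i)) && ((i == r :> nat) ==> (w i <= m))]%N.

Lemma fixesP r m w :
  reflect ((forall i, (i < r)%N -> w i = i) /\ (forall i, i = r :> nat -> (w i <= m)%N))
          (fixes r m w).
Proof.
apply: (iffP forallP) => [h|[h1 h2] i].
  split=> i; have /andP[/implyP h1 /implyP h2] := h i; first by move/h1/eqP.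
  by move/eqP/h2.
by apply/andP; split; apply/implyP; [move/h1-> | move/eqP/h2].
Qed.

Lemma fixesS r m w : fixes r m w -> fixes r m.+1 w.
Proof. by move=> /fixesP[h1 h2]; apply/fixesP; split=> // i /h2; lia. Qed.

Lemma fixes_adj r (B B1 : 'I_n) w : B1 = B.+1 :> nat -> (r <= B)%N ->
  fixes r B (w * tperm B B1)%g -> fixes r B.+1 w.
Proof.
move=> eB le /fixesP[h1 h2]; apply/fixesP; split=> i ir.
  have := h1 i ir; rewrite permM => /(congr1 (tperm B B1)); rewrite tpermK => ->.
  by rewrite tpermD //; apply/eqP => e; rewrite -e in ir; lia.
have := h2 i ir; rewrite permM; case: tpermP => [->|->|_ _]; lia.
Qed.

Lemma valid_fix r m w T i : valid_spec r m w T -> (i < r)%N -> w i = i.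
Proof.
move=> v; have [e] := ubnP (i : nat); elim: e i => // e IH i; rewrite ltnS => lei ltr.
apply/eqP; apply/negP => /negP nwi.
have fixj (j : 'I_n) : (j < i)%N -> w j = j by move=> lt; apply: IH; lia.
have [ltw|ltw|/val_inj] := ltngtP (w i) i; last by apply/eqP.
  by have := fixj _ ltw; move/perm_inj/eqP; apply/negP.
pose k := (w^-1)%g i; have wk : w k = i by rewrite permKV.
have ltik : (i < k)%N.
  have [lt|lt|/val_inj e'] := ltngtP k i => //.
    by move: wk; rewrite fixj // => e'; rewrite e' ltnn in lt.
  by move: wk; rewrite e' => e''; rewrite e'' eqxx in nwi.
have [|x xT] := @valid_mem _ _ _ _ i k v; first by rewrite /inversion ltik wk.
by have := valid_ge v xT; have := valid_le v xT; lia.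
Qed.

(** If w r > m, the cell in row r and column w r - 1 can only hold r, which is forbidden in that
    column. *)
Lemma valid_fixes r m w T : (r <= m)%N -> valid r m w T -> fixes r m w.
Proof.
move=> lem /validP v; have fix_ i := valid_fix (i := i) v.
apply/fixesP; split=> // i ei; rewrite leqNgt; apply/negP => ltm.
have lt : ((w i).-1 < n)%N by have := ltn_ord (w i); lia.
pose k := (w^-1)%g (Ordinal lt); have wk : w k = (w i).-1 :> nat by rewrite permKV.
have ltik : (i < k)%N.
  have [lti|//|/val_inj e'] := ltngtP k i.
    by move: wk; rewrite fix_; lia.
  by move: wk; rewrite e'; lia.
have [|x xT] := @valid_mem _ _ _ _ i k v; first by rewrite /inversion ltik wk; lia.
have := valid_ge v xT; have := valid_le v xT => h1 h2.
by have := valid_lt v xT; rewrite wk; lia.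
Qed.

(* A pattern 1432 may start in row r as soon as w r >= m: then the box in the *)
(* column w r - 1 of row r is forced.                                         *)
Definition avoids_from r m w : Prop := forall i j k l,
  (i < j)%N -> (j < k)%N -> (k < l)%N -> (w i < w l)%N -> (w l < w k)%N -> (w k < w j)%N ->
  (i < r)%N \/ i = r :> nat /\ (m <= w i)%N.

(** When [fixes] fails there is no filling and the recursion reads 0 = 0, so avoidance is only
    required under [fixes]. *)
Definition peelable r m w : Prop := fixes r m w -> avoids_from r m w.

(** A value above B + 1 in a position i < c would give the pattern 1432 in positions r, i, c, d. *)
Lemma peelable_top (r B B1 : 'I_n) w (c := (w^-1)%g B1) (d := (w^-1)%g B) :
    B1 = B.+1 :> nat -> (r <= B)%N -> fixes r B.+1 w -> avoids_from r B.+1 w -> (c < d)%N ->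
  (r <= c)%N /\ forall i, (i < c)%N -> (w i <= B1)%N.
Proof.
move=> eB le /fixesP[h1 h2] av ltcd.
have wc : w c = B1 by rewrite permKV.
have wd : w d = B by rewrite permKV.
have neq a b : w a <> w b -> a <> b :> nat by move=> ne /val_inj e; rewrite e in ne.
have lerc : (r <= c)%N.
  by rewrite leqNgt; apply/negP => lt; have := h1 c lt; rewrite wc => /(congr1 val) /=; lia.
split=> // i ltic; rewrite leqNgt; apply/negP => lt.
have ltri : (r < i)%N.
  have [lt'|//|e] := ltngtP i r; first by move: lt; rewrite h1 //; lia.
  by move: lt; have := h2 i e; lia.
have wr : (w r < B)%N.
  have := h2 r erefl.
  have nc : w r != B1 by rewrite -wc (inj_eq (@perm_inj _ w)); apply/eqP => e; rewrite e in ltri; lia.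
  have nd : w r != B by rewrite -wd (inj_eq (@perm_inj _ w)); apply/eqP => e; rewrite e in ltri; lia.
  by move: nc nd; rewrite -!val_eqE /=; lia.
by case: (av r i c d) => //; rewrite ?wc ?wd //; lia.
Qed.

Lemma peelableS r m w : peelable r m.+1 w -> peelable r m w.
Proof.
move=> h f i j k l *; case: (h (fixesS f) i j k l) => // [|[e le]]; [by left|by right; split; lia].
Qed.

(** The exchange creates a pattern only with c and d as its 1 and 2. If c > r, replacing c by r
    gives a forbidden pattern of w; if c = r, the pattern starts with the value B, as [avoids_from]
    permits. *)
Lemma peelable_adj (r B B1 : 'I_n) w (c := (w^-1)%g B1) (d := (w^-1)%g B) :
    B1 = B.+1 :> nat -> (r <= B)%N -> (c < d)%N -> peelable r B.+1 w ->
  peelable r B (w * tperm B B1)%g.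
Proof.
move=> eB le ltcd h f'; have f := fixes_adj eB le f'; have av := h f.
have /fixesP[f1 f2] := f; have /fixesP[f1' f2'] := f'.
set w' := (w * tperm B B1)%g in f' f1' f2' *.
have wc : w c = B1 by rewrite permKV.
have wd : w d = B by rewrite permKV.
have w'c : w' c = B by rewrite permM wc tpermR.
have w'd : w' d = B1 by rewrite permM wd tpermL.
have lt_w a b : (w' a < w' b)%N -> (a, b) != (c, d) -> (w a < w b)%N.
  move=> lt nab; have wE x : w x = tperm B B1 (w' x) by rewrite permM tpermK.
  rewrite !wE lt_adjacent_tperm //.
    apply: contra nab; rewrite -w'c -w'd => /eqP[/perm_inj-> /perm_inj->]; exact: eqxx.
  by apply: contraTneq lt => -[-> ->]; rewrite eB; lia.
move=> i j k l ij jk kl il lk kj.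
have [ltir|leri] := ltnP i r; first by left.
right; have [/eqP[ei el]|nil] := boolP ((i, l) == (c, d)); last first.
  have kd : (l, k) != (c, d) by apply/eqP => -[e1 e2]; move: kl ltcd; rewrite e1 e2; lia.
  have jd : (k, j) != (c, d) by apply/eqP => -[e1 e2]; move: jk ltcd; rewrite e1 e2; lia.
  case: (av i j k l) => //; try exact: lt_w; first by lia.
  case=> eir lew; split=> //; have ewi : w i = B1 by apply/val_inj; have := f2 i eir; rewrite /= eB; lia.
  by rewrite /w' permM ewi tpermR.
subst i l; split; last by rewrite w'c.
apply/eqP; rewrite eqn_leq leri andbT leqNgt; apply/negP => ltrc.
have nd : r != d by apply/eqP => e; move: ltrc ltcd; rewrite e; lia.
have nc : r != c by apply/eqP => e; move: ltrc; rewrite e; lia.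
have wr : (w r < B)%N.
  have := f2 r erefl.
  have nc' : w r != B1 by rewrite -wc (inj_eq (@perm_inj _ w)).
  have nd' : w r != B by rewrite -wd (inj_eq (@perm_inj _ w)).
  by move: nc' nd'; rewrite -!val_eqE /=; lia.
have hi x : (c < x)%N -> (x < d)%N -> (w' d < w' x)%N -> w x = w' x.
  move=> l1 l2 _; rewrite permM tpermD //; apply/eqP => e.
    have ex : x = d by apply: (@perm_inj _ w); rewrite wd.
    by rewrite ex ltnn in l2.
  have ex : x = c by apply: (@perm_inj _ w); rewrite wc.
  by rewrite ex ltnn in l1.
have lkj := ltn_trans lk kj.
have ltjd := ltn_trans jk kl; have ltck := ltn_trans ij jk.
case: (av r j k d) => //; rewrite ?(hi j) ?(hi k) //; try lia.
- by rewrite wd.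
- by rewrite wd; move: lk; rewrite w'd eB; lia.
Qed.

(** * Recursion for the sum over fillings *)

Section FillingSum.
Variables (R : comNzRingType) (y : 'I_n -> R).

Definition filling_weight T : R := \prod_(p : cell) \prod_(x in T p) y x.

Definition filling_sum r m : {ffun 'S_n -> R^o} :=
  [ffun w => \sum_(T : filling | valid r m w T) filling_weight T].

Lemma filling_sum0 r m w : (r <= m)%N -> ~~ fixes r m w -> filling_sum r m w = 0.
Proof.
move=> le nf; rewrite ffunE big_pred0 // => T; apply: contraNF nf.
exact: valid_fixes.
Qed.

Lemma update_update T p S S' : update (update T p S) p S' = update T p S'.
Proof. by apply/ffunP => q; rewrite !ffunE; case: eqP. Qed.

Lemma update_id T p : update T p (T p) = T.
Proof. by apply/ffunP => q; rewrite !ffunE; case: eqP => [->|]. Qed.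

Lemma filling_weight_add T p x : x \notin T p ->
  filling_weight (update T p (x |: T p)) = y x * filling_weight T.
Proof.
move=> nx; rewrite /filling_weight (bigD1 p) //= [in RHS](bigD1 p) //= !ffunE eqxx.
rewrite big_setU1 // -mulrA; congr (_ * (_ * _)).
by apply: eq_bigr => q nq; rewrite ffunE (negbTE nq).
Qed.

(** Either r is not in T (c, d), or it is there with other entries, or it is alone. Removing it
    leaves fillings of w in the first two cases and of the permutation with B and B + 1 exchanged in
    the third: these are the three terms of 1 + y_r u. *)
Lemma filling_sum_step (r B B1 : 'I_n) w : B1 = B.+1 :> nat -> (r <= B)%N ->
  peelable r B.+1 w -> filling_sum r B.+1 w = lhstep B (y r) (filling_sum r B) w.
Proof.
move=> eB le pe; rewrite /lhstep ffun_addE ffun_scaleE [lhecke _ _ w]ffunE.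
rewrite (rdescE _ eB) (adjE eB).
have [f|nf] := boolP (fixes r B.+1 w); last first.
  have -> : filling_sum r B.+1 w = 0 by apply: filling_sum0 => //; apply: leqW.
  have -> : filling_sum r B w = 0.
    by apply: filling_sum0 => //; apply: contra nf; apply: fixesS.
  have -> : filling_sum r B (w * tperm B B1)%g = 0.
    by apply: filling_sum0 => //; apply: contra nf; apply: fixes_adj.
  by rewrite addr0 if_same mulr0 addr0.
have av := pe f; set c := (w^-1)%g B1; set d := (w^-1)%g B.
rewrite [LHS]ffunE (bigID (fun T : filling => r \in T (c, d))) /= addrC.
rewrite (eq_bigl _ _ (@valid_step_notin r B B1 w eB)).
rewrite [filling_sum r B w]ffunE; congr (_ + _).
case: ifPn => [ltcd|nlt]; last first.
  rewrite mulr0 big_pred0 // => T; apply/andP => -[/validP v /(valid_mem_inv v)/andP[]].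
  by rewrite (negbTE nlt).
have [lerc top] := peelable_top eB le f av ltcd.
rewrite (bigID (fun T : filling => T (c, d) == [set r])) /= addrC mulrDr !ffunE.
congr (_ + _).
  rewrite mulr_sumr.
  rewrite (reindex_onto (fun T => update T (c, d) (r |: T (c, d)))
                        (fun T => update T (c, d) (T (c, d) :\ r))) /=; last first.
    move=> T /andP[/andP[_ rT] _]; rewrite update_update [update _ _ _ _]ffunE eqxx setD1K //.
    exact: update_id.
  have E T : update T (c, d) (r |: T (c, d)) (c, d) = r |: T (c, d).
    by rewrite ffunE eqxx.
  have Vnotin T : valid r B w T -> r \notin T (c, d).
    by rewrite -(@valid_step_notin r B B1 w eB) => /andP[].
  apply: eq_big => [T|T /andP[_ /eqP e]]; last first.
    by rewrite filling_weight_add // -e !E ffunE eqxx !inE eqxx.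
    rewrite !E update_update; apply/idP/idP => [/andP[/andP[/andP[vT rT] nT] /eqP e]|vT].
      have := @valid_step_remove r B B1 w _ vT; rewrite -/c -/d !E update_update e.
      by apply.
    rewrite (valid_step_add eB le ltcd lerc top vT) setU11 setU1K ?Vnotin //.
    rewrite update_id eqxx andbT /=.
    have [|x xT] := @valid_mem _ _ _ _ c d (elimT (validP _ _ _ _) vT).
      by rewrite /inversion ltcd !permKV eB leqnn.
    apply: contraNneq (Vnotin _ vT) => e.
    by have := setU1r r xT; rewrite e inE => /eqP ex; rewrite -ex.
rewrite mulr_sumr.
rewrite (reindex_onto (fun T => update T (c, d) [set r])
                      (fun T => update T (c, d) set0)) /=; last first.
  by move=> T /andP[_ /eqP e]; rewrite update_update -e update_id.
have E T S : update T (c, d) S (c, d) = S by rewrite ffunE eqxx.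
have E0 T : valid r B (w * tperm B B1)%g T -> T (c, d) = set0.
  move=> /validP v; apply/eqP; apply/negPn; rewrite (valid_inv v).
  by rewrite inversion_adj // eqxx andbF.
have V T : [&& valid r B.+1 w (update T (c, d) [set r]) && (r \in [set r]), true
             & update T (c, d) set0 == T] = valid r B (w * tperm B B1)%g T.
  rewrite inE eqxx andbT /=; apply/andP/idP => [[vT /eqP e]|vT].
    have := @valid_step_swap_remove r B B1 w eB le ltcd lerc _ vT.
    by rewrite -/c -/d E update_update e; apply.
  rewrite (valid_step_swap_add eB le ltcd lerc top vT) -(E0 _ vT) update_id.
  by [].
apply: eq_big => [T|T]; rewrite !E update_update eqxx.
  by rewrite -V andbA.
rewrite -andbA V => vT; have e0 := E0 _ vT.
by have := @filling_weight_add T (c, d) r; rewrite e0 inE setU0 => /(_ isT) <-.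
Qed.

Lemma lhstep_eq b (x : R) (f g : {ffun 'S_n -> R^o}) w : f w = g w ->
    (rdesc b w^-1 -> f (w * adj n b)%g = g (w * adj n b)%g) ->
  lhstep b x f w = lhstep b x g w.
Proof.
move=> e e'; rewrite /lhstep !ffun_addE !ffun_scaleE [lhecke _ f w]ffunE [lhecke _ g w]ffunE e.
by congr (_ + _ * _); case: ifP => // dw; rewrite e'.
Qed.

Lemma filling_sum_row (r : 'I_n) m (f : {ffun 'S_n -> R^o}) : (r <= m <= n.-1)%N ->
    (forall w, peelable r r w -> f w = filling_sum r r w) ->
  forall w, peelable r m w ->
    foldr (fun c f => lhstep c.1 c.2 f) f [seq (b, y r) | b <- rev (iota r (m - r))] w
    = filling_sum r m w.
Proof.
move=> /andP[le lem] ef; rewrite -(subnK le) addnK; have : (m - r + r <= n.-1)%N by rewrite subnK.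
elim: (m - r)%N => [|d IH] lt w pe; first exact: ef.
have ltB : (d + r < n)%N by lia.
have ltB1 : ((d + r).+1 < n)%N by lia.
have IHd := IH (ltnW lt).
rewrite (@filling_sum_step r (Ordinal ltB) (Ordinal ltB1)) ?leq_addl //.
rewrite -addn1 iotaD rev_cat /= addnC; apply: lhstep_eq.
  by apply: IHd; apply: peelableS.
rewrite (@rdescE _ (Ordinal ltB) (Ordinal ltB1)) // (@adjE _ (Ordinal ltB) (Ordinal ltB1)) //.
by move=> dw; apply: IHd; apply: (@peelable_adj r (Ordinal ltB)) => //; apply: leq_addl.
Qed.

Lemma peelable_next (r : 'I_n) w : peelable r r w -> peelable r.+1 n.-1 w.
Proof.
move=> pe /fixesP[h1 h2] i j k l *.
have f : fixes r r w.
  by apply/fixesP; split=> i' e; rewrite h1 ?e //; apply: leqW.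
by left; case: (pe f i j k l) => // [|[-> _] //]; apply: leqW.
Qed.

(** With m = r, an entry r would need a column below r, hence a fixed position k < r, while a cell
    has k > i >= r. With m = n - 1 the column bound is void, as w k < w i. *)
Lemma filling_sum_next (r : 'I_n) w : filling_sum r r w = filling_sum r.+1 n.-1 w.
Proof.
have ltrn := ltn_ord r.
have [f|nf] := boolP (fixes r r w); last first.
  rewrite filling_sum0 // [RHS]ffunE big_pred0 // => T; apply: contraNF nf => /validP v.
  apply/fixesP; split=> i e; rewrite (valid_fix (i := i) v) ?e //.
  exact: leqW.
have /fixesP[f1 f2] := f; rewrite !ffunE; apply: eq_bigl => T.
apply/validP/validP => v; split; try by case: v.
- move=> i k x xT; have := valid_ge v xT; rewrite leq_eqVlt => /orP[/eqP e|//].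
  have := valid_lt v xT (esym e) => ltk.
  have wk : w k = k by apply: (@perm_inj _ w); apply: f1.
  have /andP[ltik _] := valid_mem_inv v xT.
  by have := valid_le v xT; rewrite -e; move: ltk; rewrite wk; lia.
- move=> i k x xT _; have /andP[_ ltw] := valid_mem_inv v xT.
  by have := ltn_ord (w i); lia.
- by move=> i k x xT; apply: ltnW; exact: (valid_ge v xT).
- by move=> i k x xT e; have := valid_ge v xT; rewrite e ltnn.
Qed.

Lemma filling_sum_last m w : filling_sum n m w = delta n R w.
Proof.
rewrite !ffunE; have empty T p : valid n m w T -> T p = set0.
  move=> /validP v; apply/eqP/set0Pn => -[x xT]; case: p xT => i k xT.
  by have := valid_ge v xT; rewrite leqNgt ltn_ord.
case: eqVneq empty => [->|nw1] empty; last first.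
  rewrite big_pred0 // => T; apply: contra_neqF nw1 => vT.
  apply/permP => i; rewrite perm1.
  by apply: valid_fix (elimT (validP _ _ _ _) vT) (ltn_ord i).
rewrite (big_pred1 [ffun => set0]) => [|T].
  by rewrite /filling_weight big1 // => p _; rewrite ffunE big_set0.
apply/idP/eqP => [vT|->]; first by apply/ffunP => p; rewrite ffunE (empty T).
have mem0 (i k x : 'I_n) : (x \in ([ffun => set0] : filling) (i, k)) = false.
  by rewrite ffunE inE.
apply/validP; split=> [i k|i k x|i k x|i k x|i k k' x x' _|i i' k x x' _];
  rewrite ?mem0 //.
by rewrite ffunE eqxx /inversion !perm1; case: ltngtP.
Qed.

Theorem filling_sum_hecke w : avoids1432 w -> filling_sum 0 n.-1 w = hecke_sum y w.
Proof.
move=> av; rewrite /hecke_sum word_act_delta.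
have pe : peelable 0 n.-1 w.
  by move=> _ i j k l *; case: av; exists i, j, k, l.
suff H d r : (r + d = n)%N -> forall w, peelable r n.-1 w -> filling_sum r n.-1 w
    = foldr (fun c f => lhstep c.1 c.2 f) (delta n R) (rows_word y (drop r (enum 'I_n))) w.
  by rewrite (H n 0) // drop0.
elim: d r => [|d IH] r.
  rewrite addn0 => -> v _; rewrite drop_oversize ?size_enum_ord //; exact: filling_sum_last.
move=> e v pv; have lt : (r < n)%N by lia.
rewrite (drop_nth (Ordinal lt)) ?size_enum_ord // (nth_ord_enum (Ordinal lt) (Ordinal lt)).
rewrite rows_word_cons foldr_cat; apply/esym.
apply: (@filling_sum_row (Ordinal lt)) => //=; first by lia.
move=> u /(@peelable_next (Ordinal lt)) pu.
by rewrite (@filling_sum_next (Ordinal lt)) IH //=; lia.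
Qed.

End FillingSum.

End Fillings.

(** * Diagrams of fillings *)

Section KohnertDiagrams.
Variables (n : nat) (w : 'S_n).
Local Notation cell := ('I_n * 'I_n)%type.
Local Notation filling := {ffun cell -> {set 'I_n}}.
Implicit Types (i j k t r x z : 'I_n) (T : filling) (S : {set 'I_n}).

Definition fillings : {set filling} := [set T | valid 0 n.-1 w T].
Local Notation vspec T := (valid_spec 0 n.-1 w T).

Lemma fillingsP T : reflect (vspec T) (T \in fillings).
Proof. by rewrite inE; apply: validP. Qed.

Lemma in_fillings T :
    (forall i k, (T (i, k) != set0) = inversion w i k) ->
    (forall i k x, x \in T (i, k) -> (x <= i)%N) ->
    (forall i k k' x x', (w k < w k')%N -> x \in T (i, k) -> x' \in T (i, k') -> (x' <= x)%N) ->
    (forall i i' k x x', (i < i')%N -> x \in T (i, k) -> x' \in T (i', k) -> (x < x')%N) ->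
  T \in fillings.
Proof.
move=> h1 h2 h3 h4; apply/fillingsP; split=> // i k x xT _.
have : inversion w i k by rewrite -h1; apply/set0Pn; exists x.
by case/andP => _; have := ltn_ord (w i); lia.
Qed.

Lemma filling_row_uniq T i i' k x : vspec T -> x \in T (i, k) -> x \in T (i', k) -> i = i'.
Proof.
move=> v xT xT'; have [lt|lt|/val_inj //] := ltngtP i i'.
  by have := valid_col v lt xT xT'; rewrite ltnn.
by have := valid_col v lt xT' xT; rewrite ltnn.
Qed.

(** A box sits above all the ghosts that it has left. It is encoded as a set so as to be empty when
    S is. *)
Definition box_of S : {set 'I_n} := [set x in S | [forall z in S, (x <= z)%N]].

Lemma box_ofP S x : reflect (x \in S /\ forall z, z \in S -> (x <= z)%N) (x \in box_of S).
Proof.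
rewrite inE; apply: (iffP andP) => -[xS h]; split=> //.
  by move=> z zS; have /forallP/(_ z)/implyP/(_ zS) := h.
by apply/forallP => z; apply/implyP; apply: h.
Qed.

Lemma box_of_exists S x : x \in S -> exists2 z, z \in box_of S & (z <= x)%N.
Proof.
move=> xS; case: (arg_minnP (fun z : 'I_n => z : nat) xS) => z zS minz.
by exists z; [apply/box_ofP | apply: minz].
Qed.

Lemma box_of_uniq S x z : x \in box_of S -> z \in box_of S -> x = z.
Proof.
move=> /box_ofP[xS hx] /box_ofP[zS hz]; apply/val_inj/eqP.
by rewrite /= eqn_leq hx ?hz.
Qed.

Definition diagram T : grave_diagram n :=
  ([set p : cell | [exists i, p.1 \in box_of (T (i, (w^-1)%g p.2))]],
   [set p : cell | [exists i, p.1 \in T (i, (w^-1)%g p.2) :\: box_of (T (i, (w^-1)%g p.2))]]).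

Lemma boxesP T k x :
  reflect (exists i, x \in box_of (T (i, k))) ((x, w k) \in boxes (diagram T)).
Proof. by rewrite inE /= permK; apply: existsP. Qed.

Lemma ghostsP T k x :
  reflect (exists i, x \in T (i, k) :\: box_of (T (i, k))) ((x, w k) \in ghosts (diagram T)).
Proof. by rewrite inE /= permK; apply: existsP. Qed.

Lemma occupiedP T k x :
  reflect (exists i, x \in T (i, k)) ((x, w k) \in occupied (diagram T)).
Proof.
rewrite inE; apply: (iffP orP) => [[/boxesP|/ghostsP] [i h]|[i h]].
- by exists i; case/box_ofP: h.
- by exists i; case/setDP: h.
have [b|nb] := boolP (x \in box_of (T (i, k))).
  by left; apply/boxesP; exists i.
by right; apply/ghostsP; exists i; rewrite inE nb.
Qed.

Lemma eq_cells (A B : {set cell}) : (forall x k, ((x, w k) \in A) = ((x, w k) \in B)) -> A = B.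
Proof. by move=> h; apply/setP => -[x j]; have := h x ((w^-1)%g j); rewrite permKV. Qed.

(** Columns are decoded from top to bottom. If an entry x of T1 (i, k) belonged to a lower row i' in
    T2, the boxes of T2 in (i, k) and (i', k), both at most x, would be two distinct boxes of T1 (i,
    k). *)
Lemma diagram_inj : {in fillings &, injective diagram}.
Proof.
move=> T T' /fillingsP v /fillingsP v' e.
have key T1 T2 i k : vspec T1 -> vspec T2 -> diagram T1 = diagram T2 ->
    (forall j, (j < i)%N -> T1 (j, k) = T2 (j, k)) -> T1 (i, k) \subset T2 (i, k).
  move=> {T T' v v' e} v1 v2 e IH; apply/subsetP => x x1.
  have /occupiedP[i' x2] : (x, w k) \in occupied (diagram T2).
    by rewrite -e; apply/occupiedP; exists i.
  have [lti|lti|/val_inj <- //] := ltngtP i' i.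
    rewrite -IH // in x2; have ei := filling_row_uniq v1 x1 x2.
    by rewrite ei ltnn in lti.
  have [y y2] := valid_mem v2 (valid_mem_inv v1 x1).
  have [z' z'2 _] := box_of_exists y2.
  have [m' m'2 lem'] := box_of_exists x2.
  have ltz'm' : (z' < m')%N.
    by case/box_ofP: z'2 => z'2 _; case/box_ofP: m'2 => m'2 _; apply: (valid_col v2 lti z'2 m'2).
  have in1 u j : u \in box_of (T2 (j, k)) -> (i <= j)%N -> (u <= x)%N ->
      u \in box_of (T1 (i, k)).
    move=> u2 lej leu; have /boxesP[j1 u1] : (u, w k) \in boxes (diagram T1).
      by rewrite e; apply/boxesP; exists j.
    have [lt1|lt1|/val_inj <- //] := ltngtP j1 i.
      move: u1; rewrite IH // => /box_ofP[u1 _]; case/box_ofP: u2 => u2 _.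
      by move: lej; rewrite -(filling_row_uniq v2 u1 u2) leqNgt lt1.
    by case/box_ofP: u1 => u1 _; have := valid_col v1 lt1 x1 u1; rewrite ltnNge leu.
  have lez' : (z' <= x)%N by apply: leq_trans lem'; apply: ltnW.
  have ez := box_of_uniq (in1 _ _ z'2 (leqnn i) lez') (in1 _ _ m'2 (ltnW lti) lem').
  by move: ltz'm'; rewrite ez ltnn.
apply/ffunP => -[i k]; have [m] := ubnP (i : nat); elim: m i => // m IH i; rewrite ltnS => lei.
have IH' j : (j < i)%N -> T (j, k) = T' (j, k) by move=> lt; apply: IH; lia.
by apply/eqP; rewrite eqEsubset !key // => j lt; rewrite IH'.
Qed.

Lemma grave_weight_diagram T x : T \in fillings ->
  grave_weight (diagram T) x = #|[pred p | x \in T p]|.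
Proof.
move=> /fillingsP v; rewrite mnmE.
rewrite -(card_in_imset (f := fun p : cell => w p.2) (D := [pred p | x \in T p])).
  apply: eq_card => j; rewrite in_set; apply/idP/imsetP.
    rewrite -{1}(permKV w j) => /occupiedP[i xT].
    by exists (i, (w^-1)%g j); rewrite ?inE //= permKV.
  by case=> -[i k]; rewrite inE /= => xT ->; apply/occupiedP; exists i.
by move=> [i k] [i' k'] /=; rewrite !inE => xT xT' /perm_inj e; rewrite -e in xT' *;
  rewrite (filling_row_uniq v xT xT').
Qed.

Lemma diagram_weight T : T \in fillings ->
  'X_[grave_weight (diagram T)] = filling_weight (fun x => 'X_x : {mpoly int[n]}) T.
Proof.
move=> fT; rewrite mpolyXE_id /filling_weight.
under [RHS]eq_bigr do rewrite big_mkcond /=.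
rewrite exchange_big /=; apply: eq_bigr => x _; rewrite grave_weight_diagram //.
by rewrite -big_mkcond /= prodr_const.
Qed.

Lemma mdeg_diagram T : T \in fillings ->
  mdeg (grave_weight (diagram T)) = (\sum_p #|T p|)%N.
Proof.
move=> fT; rewrite mdegE.
under eq_bigr => x _ do rewrite grave_weight_diagram // -sum1_card big_mkcond /=.
rewrite exchange_big /=; apply: eq_bigr => p _.
by rewrite -big_mkcond /= sum1_card; apply: eq_card.
Qed.

Definition initial_filling : filling :=
  [ffun p => if inversion w p.1 p.2 then [set p.1] else set0].

Lemma diagram_initial : diagram initial_filling = initial_diagram w.
Proof.
congr pair; apply: eq_cells => x k.
  rewrite [RHS]inE /= permK; apply/boxesP/idP => [[i]|inv].
    rewrite ffunE /=; case: ifP => [inv|_] /box_ofP[]; last by rewrite inE.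
    by rewrite inE => /eqP->.
  exists x; rewrite ffunE /= /inversion inv; apply/box_ofP; split; first by rewrite inE.
  by move=> z; rewrite inE => /eqP->.
rewrite [RHS]inE; apply/negP => /ghostsP[i /setDP[]].
rewrite ffunE /=; case: ifP => inv; last by rewrite inE.
rewrite inE => /eqP-> /box_ofP[]; split; first by rewrite inE.
by move=> z; rewrite inE => /eqP->.
Qed.

Lemma initial_in_fillings : initial_filling \in fillings.
Proof.
have mem i k x : (x \in initial_filling (i, k)) = inversion w i k && (x == i).
  by rewrite ffunE /=; case: ifP => _; rewrite inE.
apply: in_fillings => [i k|i k x|i k k' x x' _|i i' k x x' lt].
- rewrite ffunE /=; case: ifP => _; last by rewrite eqxx.
  by apply/set0Pn; exists i; rewrite inE.
- by rewrite mem => /andP[_ /eqP->].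
- by rewrite !mem => /andP[_ /eqP->] /andP[_ /eqP->].
- by rewrite !mem => /andP[_ /eqP->] /andP[_ /eqP->].
Qed.

Lemma boxes_update T i k S x k0 : vspec T ->
  ((x, w k0) \in boxes (diagram (update T (i, k) S)))
  = if k0 == k then (x \in box_of S) || (x \notin T (i, k)) && ((x, w k0) \in boxes (diagram T))
    else (x, w k0) \in boxes (diagram T).
Proof.
move=> v; case: eqVneq => [->|nk].
  apply/boxesP/idP => [[i']|/orP[xS|/andP[nx /boxesP[i' xT]]]].
  - rewrite ffunE; case: ifP => [_ -> //|/negbT ni xT]; apply/orP; right; apply/andP; split.
      case/box_ofP: xT => xT _; apply: contra ni => xT'.
      by rewrite (filling_row_uniq v xT xT').
    by apply/boxesP; exists i'.
  - by exists i; rewrite ffunE eqxx.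
  - exists i'; rewrite ffunE; case: ifP => // /eqP[e]; case/negP: nx.
    by rewrite -e; case/box_ofP: xT.
have ne i' : (i', k0) == (i, k) = false by rewrite xpair_eqE (negbTE nk) andbF.
by apply/boxesP/boxesP => -[i']; rewrite ?ffunE ?ne => h; exists i'; rewrite ?ffunE ?ne.
Qed.

Lemma ghosts_update T i k S x k0 : vspec T ->
  ((x, w k0) \in ghosts (diagram (update T (i, k) S)))
  = if k0 == k then (x \in S :\: box_of S) || (x \notin T (i, k)) && ((x, w k0) \in ghosts (diagram T))
    else (x, w k0) \in ghosts (diagram T).
Proof.
move=> v; case: eqVneq => [->|nk].
  apply/ghostsP/idP => [[i']|/orP[xS|/andP[nx /ghostsP[i' xT]]]].
  - rewrite ffunE; case: ifP => [_ -> //|/negbT ni xT]; apply/orP; right; apply/andP; split.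
      case/setDP: xT => xT _; apply: contra ni => xT'.
      by rewrite (filling_row_uniq v xT xT').
    by apply/ghostsP; exists i'.
  - by exists i; rewrite ffunE eqxx.
  - exists i'; rewrite ffunE; case: ifP => // /eqP[e]; case/negP: nx.
    by rewrite -e; case/setDP: xT.
have ne i' : (i', k0) == (i, k) = false by rewrite xpair_eqE (negbTE nk) andbF.
by apply/ghostsP/ghostsP => -[i']; rewrite ?ffunE ?ne => h; exists i'; rewrite ?ffunE ?ne.
Qed.

(** Termination measure for undoing moves: lowering a box decreases it. *)
Definition filling_height T : nat := \sum_(p : cell) \sum_(x in T p) (n - x).

Lemma filling_height_update T p S :
  (\sum_(x in S) (n - x) < \sum_(x in T p) (n - x))%N ->
  (filling_height (update T p S) < filling_height T)%N.
Proof.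
move=> lt; rewrite /filling_height (bigD1 p) //= [X in (_ < X)%N](bigD1 p) //= ffunE eqxx.
rewrite (eq_bigr (fun q => \sum_(x in T q) (n - x))%N) ?ltn_add2r // => q /negbTE nq.
by rewrite ffunE nq.
Qed.

(** In the lowest row i with a cell different from {i}, the leftmost such cell has its box moved
    down from r to r + 1. Cells further down, or further left in row i, are in initial position, so
    all inequalities survive. The move undone is a K-move exactly when r + 1 was already a ghost of
    this cell. *)
Lemma diagram_predecessor T : T \in fillings -> T != initial_filling ->
  exists T1, [/\ T1 \in fillings, box_move (diagram T1) (diagram T)
    & (filling_height T1 < filling_height T)%N].
Proof.
move=> fT nT; have v := elimT (fillingsP T) fT.
pose bad i k := inversion w i k && (T (i, k) != [set i]).
have [i0 [k0 bad0]] : exists i k, bad i k.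
  have [/existsP[i /existsP[k b]]|/existsPn h] := boolP [exists i, exists k, bad i k].
    by exists i, k.
  case/eqP: nT; apply/ffunP => -[i k]; rewrite ffunE /=; case: ifPn => inv.
    by have /existsPn/(_ k) := h i; rewrite /bad inv /= negbK => /eqP.
  by apply/eqP; rewrite -[_ == _]negbK (valid_inv v).
have exi : [exists k, bad i0 k] by apply/existsP; exists k0.
case: (@arg_maxnP _ i0 (fun i => [exists k, bad i k]) val exi) => i /existsP[k1 bad1] maxi.
case: (@arg_minnP _ k1 (bad i) (val \o w) bad1) => k /andP[inv nTi] mink.
clear i0 k0 bad0 exi k1 bad1.
have below i' k' x : (i < i')%N -> x \in T (i', k') -> x = i'.
  move=> lt xT; have inv' := valid_mem_inv v xT.
  have : ~~ bad i' k' by apply: contraL lt => b; rewrite -leqNgt; apply: maxi; apply/existsP; exists k'.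
  by rewrite /bad inv' negbK => /eqP e; move: xT; rewrite e inE => /eqP.
have left_ k' x : (w k' < w k)%N -> x \in T (i, k') -> x = i.
  move=> lt xT; have inv' := valid_mem_inv v xT.
  have : ~~ bad i k' by apply: contraL lt => b; rewrite -leqNgt; apply: mink.
  by rewrite /bad inv' negbK => /eqP e; move: xT; rewrite e inE => /eqP.
have [x0 x0T] := valid_mem v inv.
have [r rbox _] := box_of_exists x0T; have [rT minr] := elimT (box_ofP _ _) rbox.
have ltri : (r < i)%N.
  rewrite ltn_neqAle (valid_le v rT) andbT; apply: contra nTi => /eqP/val_inj eri.
  have iT : i \in T (i, k) by rewrite -[X in X \in _]eri.
  rewrite eqEsubset sub1set iT andbT; apply/subsetP => x xT; rewrite inE -val_eqE.
  by rewrite eqn_leq (valid_le v xT) -eri minr.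
have lt1 : (r.+1 < n)%N by have := ltn_ord i; lia.
pose r1 := Ordinal lt1; pose S := r1 |: (T (i, k) :\ r).
have memS x : x \in S -> x = r1 \/ (x \in T (i, k) /\ x <> r).
  by rewrite !inE => /orP[/eqP->|/andP[/eqP ? ?]]; [left | right].
have geS x : x \in S -> (r1 <= x)%N.
  case/memS => [->//|[xT nx]]; have := minr x xT; rewrite leq_eqVlt => /orP[/eqP/val_inj e|//].
  by case: nx.
have leS x : x \in S -> (x <= i)%N by case/memS => [->//|[xT _]]; apply: (valid_le v xT).
have r1S : r1 \in S by rewrite !inE eqxx.
have boxS : box_of S = [set r1].
  apply/setP => x; rewrite in_set1; apply/box_ofP/eqP => [[xS h]|->]; last by split.
  by apply/val_inj/eqP; rewrite eqn_leq (h _ r1S) (geS _ xS).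
pose T1 := update T (i, k) S.
have T1E i' k' : (i', k') != (i, k) -> T1 (i', k') = T (i', k').
  by rewrite ffunE => /negbTE->.
have T1ik : T1 (i, k) = S by rewrite ffunE eqxx.
have fT1 : T1 \in fillings.
  apply: in_fillings.
  - move=> i' k'; rewrite -(valid_inv v); have [/eqP[-> ->]|ne] := boolP ((i', k') == (i, k)).
      rewrite T1ik; have -> : S != set0 by apply/set0Pn; exists r1.
      by apply/esym/set0Pn; exists r.
    by rewrite T1E.
  - move=> i' k' x; have [/eqP[-> ->]|ne] := boolP ((i', k') == (i, k)).
      by rewrite T1ik; apply: leS.
    by rewrite T1E //; apply: (valid_le v).
  - move=> i' k1 k2 x x' lt.
    have [/eqP[e1 e2]|ne1] := boolP ((i', k1) == (i, k)).
      subst i' k1; rewrite T1ik T1E => [/geS lex x'T|].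
        by apply: leq_trans lex; apply: leqW; apply: (valid_row v lt rT x'T).
      by rewrite xpair_eqE eqxx /=; apply: contraTneq lt => ->; rewrite ltnn.
    have [/eqP[e1 e2]|ne2] := boolP ((i', k2) == (i, k)).
      by subst i' k2; rewrite T1ik T1E // => /(left_ _ _ lt) -> /leS.
    by rewrite !T1E //; apply: (valid_row v).
  - move=> i1 i2 k' x x' lt.
    have [/eqP[e1 e2]|ne1] := boolP ((i1, k') == (i, k)).
      subst i1 k'; rewrite T1ik T1E => [/leS lex /(below _ _ _ lt) ->|].
        exact: leq_ltn_trans lt.
      by rewrite xpair_eqE eqxx andbT; apply: contraTneq lt => ->; rewrite ltnn.
    have [/eqP[e1 e2]|ne2] := boolP ((i2, k') == (i, k)).
      subst i2 k'; rewrite T1ik T1E // => xT /geS; apply: leq_ltn_trans.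
      exact: ltnW (valid_col v lt xT rT).
    by rewrite !T1E //; apply: (valid_col v).
exists T1; split=> //; last first.
  apply: filling_height_update; rewrite (bigD1 r1) //= [X in (_ < X)%N](bigD1 r) //=.
  rewrite -addSn; apply: leq_add; first by rewrite subnSK.
  rewrite big_mkcond [X in (_ <= X)%N]big_mkcond leq_sum //= => x _.
  case: ifP => // /andP[/memS[->|[-> /eqP->]] //]; by rewrite eqxx.
have nr1 i' : i' != i -> r1 \notin T (i', k).
  move=> ne; apply/negP => r1T; have [lt|lt|/val_inj e] := ltngtP i' i; last by rewrite e eqxx in ne.
    by have := valid_col v lt r1T rT; rewrite ltnNge leqnSn.
  by have := below _ _ _ lt r1T => e; move: lt; rewrite -e /= ltnNge ltri.
have mov : box_movable (diagram T1) r1 (w k) r.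
  apply/and4P; split.
  - by rewrite boxes_update // eqxx boxS inE eqxx.
  - apply/andP; split; first by apply/occupiedP; exists i; rewrite T1ik.
    apply/forallP => j'; apply/implyP; rewrite -(permKV w j').
    move: (_ j') => k' /occupiedP[i' x1]; rewrite leqNgt; apply/negP => ltk.
    have [/eqP[e1 e2]|ne] := boolP ((i', k') == (i, k)).
      by rewrite e2 ltnn in ltk.
    rewrite T1E // in x1; have [lt|lt|/val_inj e] := ltngtP i' i.
    (* With r + 1 further right in a row i' < i, the cell (i', k) would have an entry at least r + 1
       by its row, yet less than r by its column. *)
    - have /andP[lt' ltw] := valid_mem_inv v x1.
      have /andP[ltik ltwk] := inv.
      have [y yT] : exists y, y \in T (i', k).
        by apply: (valid_mem v); rewrite /inversion (ltn_trans lt) ?(ltn_trans ltk).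
      have := leq_ltn_trans (valid_row v ltk yT x1) (valid_col v lt yT rT).
      by rewrite ltnNge leqnSn.
    - by have e := below _ _ _ lt x1; move: lt; rewrite -e ltnNge ltri.
    - by rewrite e in x1; have := valid_row v ltk rT x1; rewrite ltnn.
  - apply/and3P; split=> //.
      apply/occupiedP => -[i']; have [/eqP[->]|ne] := boolP ((i', k) == (i, k)).
        by rewrite T1ik => /geS; rewrite ltnn.
      by rewrite T1E // => r'T; move: ne; rewrite (filling_row_uniq v r'T rT) eqxx.
    by apply/forallP => x; apply/implyP => /andP[].
  - apply/forallP => x; apply/implyP => /andP[/andP[l1 l2] _].
    have -> : x = r1 by apply/val_inj/eqP; rewrite /= eqn_leq l2.
    by rewrite boxes_update // eqxx boxS inE eqxx.
have eb : boxes (diagram T) = (r, w k) |: (boxes (diagram T1) :\ (r1, w k)).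
  apply: eq_cells => x k0; rewrite in_setU1 in_setD1 boxes_update // !xpair_eqE.
  rewrite !(inj_eq (@perm_inj _ w)); have [->|_] := eqVneq k0 k; last by rewrite !andbF.
  rewrite !andbT boxS in_set1; apply/idP/idP => [/[dup] bx /boxesP[i' xT]|].
    have [e|ne] := eqVneq i' i.
      by rewrite e in xT; rewrite (box_of_uniq xT rbox) eqxx.
    have [xT' _] := elimT (box_ofP _ _) xT.
    have nxr1 : x != r1 by apply: contra (nr1 i' ne) => /eqP <-.
    rewrite nxr1 bx andbT; apply/orP; right; apply/orP; right.
    by apply: contra ne => xT2; rewrite (filling_row_uniq v xT' xT2).
  case/orP => [/eqP->|/andP[nx]]; first by apply/boxesP; exists i.
  by rewrite (negbTE nx) => /andP[].
have eg : ghosts (diagram T)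
    = (if r1 \in T (i, k) then [set (r1, w k)] else set0) :|: ghosts (diagram T1).
  apply: eq_cells => x k0; rewrite in_setU ghosts_update //.
  have -> : ((x, w k0) \in (if r1 \in T (i, k) then [set (r1, w k)] else set0))
      = [&& r1 \in T (i, k), x == r1 & k0 == k].
    case: ifP => _; last by rewrite in_set0.
    by rewrite in_set1 xpair_eqE (inj_eq (@perm_inj _ w)).
  have [->|_] := eqVneq k0 k; last by rewrite !andbF.
  rewrite andbT boxS in_setD in_set1; apply/idP/idP => [/[dup] gx /ghostsP[i' /setDP[xT nb]]|].
    have [e|ne] := eqVneq i' i; last first.
      apply/orP; right; apply/orP; right; rewrite gx andbT.
      by apply: contra ne => xT2; rewrite (filling_row_uniq v xT xT2).
    rewrite e in xT nb; have [e1|nx] := eqVneq x r1.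
      by rewrite -e1 xT.
    apply/orP; right; apply/orP; left; rewrite !inE (negbTE nx) xT andbT /=.
    by apply: contra nb => /eqP->.
  case/or3P => [/andP[r1T /eqP->]|/andP[nx /memS[e|[xT /eqP nxr]]]|/andP[_ //]].
  - apply/ghostsP; exists i; rewrite in_setD r1T andbT.
    by apply/negP => /box_ofP[_ /(_ r rT)]; rewrite ltnn.
  - by rewrite e eqxx in nx.
  - apply/ghostsP; exists i; rewrite in_setD xT andbT.
    by apply: contra nxr => xb; rewrite (box_of_uniq xb rbox).
have [r1T|nr1T] := boolP (r1 \in T (i, k)); apply/orP; [right|left].
  apply/existsP; exists r1; apply/existsP; exists (w k); apply/existsP; exists r.
  rewrite mov -eb; apply/eqP; transitivity (boxes (diagram T), ghosts (diagram T)) => //.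
  by rewrite eg r1T.
apply/existsP; exists r1; apply/existsP; exists (w k); apply/existsP; exists r.
rewrite mov -eb; apply/eqP; transitivity (boxes (diagram T), ghosts (diagram T)) => //.
by rewrite eg (negbTE nr1T) set0U.
Qed.

Lemma diagram_KKoh T : T \in fillings -> diagram T \in KKoh w.
Proof.
have [m] := ubnP (filling_height T); elim: m T => // m IH T; rewrite ltnS => lem fT.
have [->|nT] := eqVneq T initial_filling; first by rewrite diagram_initial inE connect0.
have [T1 [fT1 mv lt]] := diagram_predecessor fT nT.
have := IH T1 (leq_trans lt lem) fT1; rewrite !inE => h.
exact: connect_trans h (connect1 mv).
Qed.

End KohnertDiagrams.

(** * Closure under Kohnert moves *)

Section KohnertClosure.
Variables (n : nat) (w : 'S_n).
Local Notation cell := ('I_n * 'I_n)%type.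
Local Notation filling := {ffun cell -> {set 'I_n}}.
Implicit Types (i j k t r x z : 'I_n) (T : filling) (S : {set 'I_n}).
Local Notation vspec T := (valid_spec 0 n.-1 w T).
Local Notation diagram := (diagram w).

Lemma filling_update T i k S x0 : vspec T -> x0 \in S ->
    (forall x, x \in S -> exists2 z, z \in T (i, k) & (z <= x)%N) ->
    (forall x, x \in S -> exists2 z, z \in T (i, k) & (x <= z)%N) ->
    (forall k' x x', (w k < w k')%N -> x \in S -> x' \in T (i, k') -> (x' <= x)%N) ->
  update T (i, k) S \in fillings w.
Proof.
move=> v x0S lo hi rowS; set T1 := update _ _ _.
have T1E i' k' : (i', k') != (i, k) -> T1 (i', k') = T (i', k').
  by rewrite ffunE => /negbTE->.
have T1ik : T1 (i, k) = S by rewrite ffunE eqxx.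
apply: in_fillings.
- move=> i' k'; rewrite -(valid_inv v); have [/eqP[-> ->]|ne] := boolP ((i', k') == (i, k)).
    rewrite T1ik; have [z zT _] := lo x0 x0S.
    have -> : S != set0 by apply/set0Pn; exists x0.
    by apply/esym/set0Pn; exists z.
  by rewrite T1E.
- move=> i' k' x; have [/eqP[-> ->]|ne] := boolP ((i', k') == (i, k)).
    by rewrite T1ik => /hi[z zT lez]; apply: leq_trans lez (valid_le v zT).
  by rewrite T1E //; apply: (valid_le v).
- move=> i' k1 k2 x x' lt.
  have [/eqP[e1 e2]|ne1] := boolP ((i', k1) == (i, k)).
    subst i' k1; rewrite T1ik T1E => [xS x'T|]; first exact: rowS lt xS x'T.
    by rewrite xpair_eqE eqxx /=; apply: contraTneq lt => ->; rewrite ltnn.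
  have [/eqP[e1 e2]|ne2] := boolP ((i', k2) == (i, k)).
    subst i' k2; rewrite T1ik T1E // => xT /hi[z zT lez].
    exact: leq_trans lez (valid_row v lt xT zT).
  by rewrite !T1E //; apply: (valid_row v).
- move=> i1 i2 k' x x' lt.
  have [/eqP[e1 e2]|ne1] := boolP ((i1, k') == (i, k)).
    subst i1 k'; rewrite T1ik T1E => [/hi[z zT lez] x'T|].
      exact: leq_ltn_trans lez (valid_col v lt zT x'T).
    by rewrite xpair_eqE eqxx andbT; apply: contraTneq lt => ->; rewrite ltnn.
  have [/eqP[e1 e2]|ne2] := boolP ((i2, k') == (i, k)).
    subst i2 k'; rewrite T1ik T1E // => xT /lo[z zT lez].
    exact: leq_trans (valid_col v lt xT zT) lez.
  by rewrite !T1E //; apply: (valid_col v).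
Qed.

Lemma landing_rowP E r j t : landing_row E r j t ->
  [/\ (t < r)%N, (t, j) \notin occupied E
    & forall x, (t < x)%N -> (x < r)%N -> (x, j) \in occupied E].
Proof.
case/and3P => lt nt /forallP h; split=> // x tx xr; apply: contraT => nx.
by have := h x; rewrite xr nx /= leqNgt tx.
Qed.

(** The box of the moving ghost lies strictly above the landing row, since only ghosts may be jumped
    over. So the ghost stays within the range of its own cell and the minimum is unchanged. *)
Lemma ghost_closed T F : T \in fillings w ->
    ghost_kohnert_move (diagram T) F || ghost_K_kohnert_move (diagram T) F ->
  exists2 T', T' \in fillings w & F = diagram T'.
Proof.
move=> /fillingsP v h.
have [r [j [t [mv eF]]]] : exists r j t, ghost_movable (diagram T) r j t /\
   (F = (boxes (diagram T), (t, j) |: (ghosts (diagram T) :\ (r, j)))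
    \/ F = (boxes (diagram T), (t, j) |: ghosts (diagram T))).
  case/orP: h => /existsP[r /existsP[j /existsP[t /andP[mv /eqP e]]]]; exists r, j, t; split=> //.
    by left.
  by right.
move: mv eF; rewrite -(permKV w j); move: (_ j) => k {j}.
case/and4P => /ghostsP[i /setDP[rT nrb]] _ /landing_rowP[ltr nocc occ] /forallP gh eF.
have [m mb ltm] := box_of_exists rT; have [mT minm] := elimT (box_ofP _ _) mb.
have ltmr : (m < r)%N.
  by rewrite ltn_neqAle ltm andbT; apply: contra nrb => /eqP/val_inj <-.
have tnT i' : t \notin T (i', k).
  by apply: contra nocc => tT; apply/occupiedP; exists i'.
have ltmt : (m < t)%N.
  rewrite ltnNge leq_eqVlt negb_or; apply/andP; split.
    by apply: contra (tnT i) => /eqP/val_inj ->.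
  apply/negP => ltt; have := gh m; rewrite ltt ltmr /= => /implyP h'.
  have /h'/ghostsP[i' /setDP[mT']] : (m, w k) \in occupied (diagram T).
    by apply/occupiedP; exists i.
  by rewrite -(filling_row_uniq v mT mT') mb.
(* [D] holds what disappears: {r} for the ordinary ghost move, nothing for the K-move. *)
have [D [DE eFD]] : exists D : {set 'I_n}, D \subset [set r] /\ F = (boxes (diagram T),
    (t, w k) |: (ghosts (diagram T) :\: [set (x, w k) | x in D])).
  case: eF => ->; [exists [set r] | exists set0]; split; rewrite ?sub0set //.
    by rewrite imset_set1.
  by rewrite imset0 setD0.
pose S := t |: (T (i, k) :\: D).
have memD x : x \in D -> x = r by move/(subsetP DE)/set1P.
have memS x : (x \in S) = (x == t) || (x \notin D) && (x \in T (i, k)).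
  by rewrite !inE.
have SP x : x \in S -> [/\ (m <= x)%N & x = t \/ x \in T (i, k)].
  rewrite memS => /orP[/eqP->|/andP[_ xT]]; split; [exact: ltnW|by left|exact: minm|by right].
have mS : m \in S.
  by rewrite memS mT andbT; apply/orP; right; apply: contraTN ltmr => /memD ->; rewrite ltnn.
have mbS : m \in box_of S by apply/box_ofP; split=> // z /SP[].
have eqb : box_of S = box_of (T (i, k)).
  by apply/setP => x; apply/idP/idP => xb;
    [rewrite (box_of_uniq xb mbS) | rewrite (box_of_uniq xb mb)].
have lttr : (t <= r)%N := ltnW ltr.
exists (update T (i, k) S).
  apply: (@filling_update T i k S m v mS) => [x /SP[mx _]|x /SP[_ [->|xT]]|k' x x' lt /SP[mx _] x'T].
  - by exists m.
  - by exists r.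
  - by exists x.
  - exact: leq_trans (valid_row v lt mT x'T) mx.
rewrite eFD; congr pair; apply: (@eq_cells _ w) => x k0.
  rewrite boxes_update // eqb; have [->|//] := eqVneq k0 k.
  apply/idP/orP => [|[xb|/andP[] //]]; last by apply/boxesP; exists i.
  move=> /[dup] bx /boxesP[i' xT]; rewrite bx andbT.
  have [e|ne] := eqVneq i' i; first by rewrite e in xT; left.
  right; apply: contra ne => xT2; case/box_ofP: xT => xT _.
  by rewrite (filling_row_uniq v xT xT2).
rewrite in_setU1 in_setD ghosts_update // xpair_eqE (inj_eq (@perm_inj _ w)).
have imD : ((x, w k0) \in [set (x, w k) | x in D]) = (x \in D) && (k0 == k).
  apply/imsetP/andP => [[z zD [-> /perm_inj ->]]|[xD /eqP->]]; first by rewrite zD eqxx.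
  by exists x.
rewrite imD; have [->|_] := eqVneq k0 k; last by rewrite !andbF.
rewrite !andbT eqb in_setD memS.
apply/idP/idP.
  case/orP => [/eqP->|/andP[xD /[dup] gx /ghostsP[i' /setDP[xT nb]]]].
    rewrite eqxx orTb andbT; apply/orP; left; apply: contra (tnT i) => /box_ofP[]; done.
  have [e|ne] := eqVneq i' i.
    by rewrite e in xT nb; rewrite nb xD xT orbT.
  apply/orP; right; rewrite gx andbT; apply: contra ne => xT2.
  by rewrite (filling_row_uniq v xT xT2).
case/orP => [/andP[nb /orP[-> //|/andP[xD xT]]]|/andP[nx gx]].
  by apply/orP; right; rewrite xD; apply/ghostsP; exists i; rewrite in_setD nb.
apply/orP; right; rewrite gx andbT; apply: contra nx => /memD ->; exact: rT.
Qed.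

(* A box cannot jump over a box whose right neighbour blocks it: the empty    *)
(* landing row provides the 1 of a pattern 1432.                              *)
Lemma jump_unblocked T k r t : avoids1432 w -> vspec T ->
    (forall i, t \notin T (i, k)) ->
    (forall x, (t < x)%N -> (x <= r)%N -> exists i, x \in box_of (T (i, k))) ->
    (forall i k', (w k < w k')%N -> r \notin T (i, k')) ->
  forall i k' z, (w k < w k')%N -> (t < z)%N -> (z <= r)%N -> z \in T (i, k) ->
    z \notin T (i, k').
Proof.
move=> av v tnT occ rfree i k' z ltk tz zr zT.
have [d] := ubnP (r - z); elim: d i z tz zr zT => // d IH i z tz zr zT led.
have [ezr|nzr] := eqVneq z r; first by rewrite ezr; exact: rfree.
have ltzr : (z < r)%N by rewrite ltn_neqAle zr andbT.
have ltz1 : (z.+1 < n)%N by apply: leq_ltn_trans ltzr (ltn_ord r).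
pose z1 := Ordinal ltz1.
have tz1 : (t < z1)%N by apply: ltnW; rewrite ltnS.
have [j1 /box_ofP[z1T minz1]] := occ z1 tz1 ltzr.
have ltij : (i < j1)%N.
  have [//|lt|/val_inj e] := ltngtP i j1.
    by have := valid_col v lt z1T zT; rewrite ltnNge leqnSn.
  by rewrite -e in minz1; have := minz1 z zT; rewrite ltnn.
have z1free : z1 \notin T (j1, k').
  by apply: IH => //=; rewrite -(subnSK ltzr) in led.
apply/negP => zT'.
have /andP[ltik ltwik] := valid_mem_inv v zT.
have /andP[ltjk ltwjk] := valid_mem_inv v z1T.
have /andP[ltik' ltwik'] := valid_mem_inv v zT'.
(* The 1 of the pattern. Without it, column k has cells in all rows up to i, each forced to hold its
   own row, and row t could not be empty. *)
have [p ltpi ltwp] : exists2 p : 'I_n, (p < i)%N & (w p < w k)%N.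
  have [/existsP[p /andP[]]|/existsPn np] := boolP [exists p : 'I_n, (p < i) && (w p < w k)]%N.
    by exists p.
  have inv (p : 'I_n) : (p <= i)%N -> inversion w p k.
    rewrite leq_eqVlt => /orP[/eqP/val_inj->|lt]; first by rewrite /inversion ltik ltwik.
    rewrite /inversion (ltn_trans lt ltik) /= ltn_neqAle.
    have := np p; rewrite lt /= -leqNgt => ->; rewrite andbT.
    by apply/eqP => /val_inj/perm_inj e; rewrite -e ltnNge ltnW in lt.
  have full m (p : 'I_n) x : p = m :> nat -> (p <= i)%N -> x \in T (p, k) -> (p <= x)%N.
    elim: m p x => [|m IHm] p x ep lepi xT; first by rewrite ep.
    have ltm : (m < n)%N by apply: ltn_trans (ltn_ord p); rewrite ep.
    have leq_mi : (Ordinal ltm <= i)%N by rewrite /= ltnW // -ep.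
    have [y yT] := valid_mem v (inv _ leq_mi).
    have ltmp : (Ordinal ltm < p)%N by rewrite /= ep.
    rewrite ep; apply: leq_ltn_trans (valid_col v ltmp yT xT).
    exact: (IHm (Ordinal ltm)).
  have ezi : z = i by apply/val_inj/eqP; rewrite eqn_leq (valid_le v zT) (full i i).
  have letl : (t <= i)%N by rewrite -ezi ltnW.
  have [y yT] := valid_mem v (inv t letl).
  have eyt : y = t by apply/val_inj/eqP; rewrite eqn_leq (valid_le v yT) (full t t).
  by move: yT; rewrite eyt (negbTE (tnT t)).
(* The 4 is at i and the 2 at k. The 3 is at j1 or at k', unless (j1, k') is a cell; then its
   entries are squeezed to z + 1, which was excluded. *)
have [lejk|ltkj] := leqP (w j1) (w k').
  by case: av; exists p, i, j1, k; split; split=> //; apply: leq_ltn_trans ltwik'.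
have [ltjk'|lek'j] := ltnP j1 k'.
  have [u uT] : exists u, u \in T (j1, k') by apply: (valid_mem v); rewrite /inversion ltjk'.
  have := valid_row v ltk z1T uT; have := valid_col v ltij zT' uT => l1 l2.
  have eu : u = z1 by apply/val_inj/eqP; rewrite eqn_leq l2.
  by rewrite -eu uT in z1free.
case: av; exists p, i, k', k; split; split=> //.
exact: leq_ltn_trans ltjk.
Qed.

Section Jump.
Variables (r t : 'I_n).
Hypothesis ltr : (t < r)%N.

(** A box jumping from row r to row t over boxes in all rows between leaves the same set of boxes as
    moving each of them up by one, which keeps the column strictly increasing. *)
Definition jump x : 'I_n :=
  if (t < x <= r)%N then Ordinal (leq_ltn_trans (leq_pred x) (ltn_ord x)) else x.

Lemma jumpE x : jump x = (if (t < x <= r)%N then x.-1 else x) :> nat.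
Proof. by rewrite /jump; case: ifP. Qed.

Lemma jump_le x : (jump x <= x)%N.
Proof. by rewrite jumpE; case: ifP => _ //; apply: leq_pred. Qed.

Lemma jump_mono x z : (x <= z)%N -> (jump x <= jump z)%N.
Proof. by rewrite !jumpE; case: ifP; case: ifP; lia. Qed.

Lemma jump_lt x z : x != t -> (x < z)%N -> (jump x < jump z)%N.
Proof. by rewrite -val_eqE !jumpE /=; case: ifP; case: ifP; lia. Qed.

Lemma jumpr : (jump r < r)%N.
Proof. by rewrite jumpE; case: ifP; lia. Qed.

End Jump.

(** Shifting column k by [jump] respects the cells further right because [jump_unblocked] rules out
    equal entries there. [K] is {r} for the K-move, whose ghost joins the cell of the box that left
    row r, and empty otherwise. *)
Lemma box_closed T F : avoids1432 w -> T \in fillings w -> box_move (diagram T) F ->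
  exists2 T', T' \in fillings w & F = diagram T'.
Proof.
move=> av /fillingsP v h.
have [r [j [t [mv eF]]]] : exists r j t, box_movable (diagram T) r j t /\
   (exists2 K : {set 'I_n}, K \subset [set r] & F = ((t, j) |: (boxes (diagram T) :\ (r, j)),
      [set (x, j) | x in K] :|: ghosts (diagram T))).
  case/orP: h => /existsP[r /existsP[j /existsP[t /andP[mv /eqP->]]]]; exists r, j, t; split=> //.
    by exists set0; rewrite ?sub0set // imset0 set0U.
  by exists [set r]; rewrite // imset_set1.
move: mv eF; rewrite -(permKV w j); move: (_ j) => k {j}.
case/and4P => /boxesP[i0 rb] /andP[_ /forallP right] /landing_rowP[ltr nocc occ] /forallP bx.
case=> K subK eF; have [rT minr] := elimT (box_ofP _ _) rb.
have tnT i : t \notin T (i, k).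
  by apply: contra nocc => tT; apply/occupiedP; exists i.
have col x : (t < x)%N -> (x <= r)%N -> exists i, x \in box_of (T (i, k)).
  move=> tx xr; apply/(@boxesP _ w); have := bx x; rewrite tx xr /= => /implyP; apply.
  move: xr; rewrite leq_eqVlt => /orP[/eqP/val_inj->|]; last exact: occ.
  by apply/occupiedP; exists i0.
have rfree i k' : (w k < w k')%N -> r \notin T (i, k').
  move=> lt; apply/negP => rT'; have := right (w k'); rewrite leqNgt lt implybF => /negP; apply.
  by apply/occupiedP; exists i.
have unblocked := jump_unblocked av v tnT col rfree.
have memK x : x \in K -> x = r by move/(subsetP subK)/set1P.
pose T' : filling := [ffun p => if p.2 == k
  then [set jump r t x | x in T p] :|: (if p.1 == i0 then K else set0) else T p].
have T'E i k' : k' != k -> T' (i, k') = T (i, k') by rewrite ffunE /= => /negbTE->.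
have T'P i x : reflect ((exists2 z, z \in T (i, k) & x = jump r t z) \/ (i = i0 /\ x \in K))
    (x \in T' (i, k)).
  rewrite ffunE /= eqxx in_setU; apply: (iffP orP) => -[].
  - by case/imsetP => z zT ->; left; exists z.
  - by case: eqP => [->|_]; [right | rewrite in_set0].
  - by case=> z zT ->; left; apply/imsetP; exists z.
  - by case=> -> xK; right; rewrite eqxx.
have T'le i x : x \in T' (i, k) -> exists2 z, z \in T (i, k) & (x <= z)%N.
  by case/T'P => [[z zT ->]|[-> /memK->]]; [exists z => //; apply: jump_le | exists r].
have fT' : T' \in fillings w.
  apply: in_fillings.
  - move=> i k'; rewrite -(valid_inv v); have [->|ne] := eqVneq k' k; last by rewrite T'E.
    apply/set0Pn/set0Pn => [[x /T'le[z zT _]]|[z zT]]; first by exists z.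
    by exists (jump r t z); apply/T'P; left; exists z.
  - move=> i k' x; have [->|ne] := eqVneq k' k; last by rewrite T'E //; apply: (valid_le v).
    by case/T'le => z zT lez; apply: leq_trans lez (valid_le v zT).
  - move=> i k1 k2 x x' lt; have [e1|ne1] := eqVneq k1 k; last first.
      have [e2|ne2] := eqVneq k2 k; last by rewrite !T'E //; apply: (valid_row v).
      subst k2; rewrite [T' (i, k1)]T'E // => xT /T'le[z zT lez].
      exact: leq_trans lez (valid_row v lt xT zT).
    have ne2 : k2 != k by apply: contraTneq lt => ->; rewrite e1 ltnn.
    subst k1; rewrite [T' (i, k2)]T'E // => /T'P[[z zT ->] x'T|[-> /memK->]]; last first.
      exact: (valid_row v lt rT).
    have := valid_row v lt zT x'T; rewrite jumpE; case: ifP => // /andP[tz zr].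
    rewrite leq_eqVlt => /orP[/eqP/val_inj e|]; last by case: (z : nat) tz.
    by have := unblocked i k2 z lt tz zr zT; rewrite -e x'T.
  - move=> i1 i2 k' x x' lt; have [->|ne] := eqVneq k' k; last by rewrite !T'E //; apply: (valid_col v).
    case/T'P => [[z zT ->]|[ei /memK->]].
      case/T'P => [[z' z'T ->]|[ei /memK->]].
        apply: jump_lt (valid_col v lt zT z'T) => //.
        by apply: contraTneq zT => ->.
      subst i2; apply: leq_ltn_trans (jump_le _ _ _) _; exact: (valid_col v lt zT rT).
    subst i1; case/T'P => [[z' z'T ->]|[ei _]]; last by rewrite ei ltnn in lt.
    have l := valid_col v lt rT z'T; rewrite jumpE [(z' <= r)%N]leqNgt l andbF; exact: l.
have box_jump i m : m \in box_of (T (i, k)) -> jump r t m \in box_of (T' (i, k)).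
  move=> /box_ofP[mT minm]; apply/box_ofP; split; first by apply/T'P; left; exists m.
  move=> x /T'P[[z zT ->]|[ei /memK->]]; first by apply: jump_mono => //; apply: minm.
  by apply: leq_trans (jump_le _ _ _) _; apply: minm; rewrite ei.
have moved_box z i : z \in T (i, k) -> (t < z <= r)%N -> z \in box_of (T (i, k)).
  move=> zT /andP[tz zr]; have [i' zb] := col z tz zr; have [zT' _] := elimT (box_ofP _ _) zb.
  by rewrite (filling_row_uniq v zT zT').
exists T' => //; rewrite {}eF; congr pair; apply: (@eq_cells _ w) => x k0.
  rewrite in_setU1 in_setD1 !xpair_eqE (inj_eq (@perm_inj _ w)).
  have [->|nk] := eqVneq k0 k; last first.
    rewrite !andbF /=.
    by apply/boxesP/boxesP => -[i xT]; exists i; rewrite ?T'E // in xT *.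
  rewrite !andbT; apply/idP/boxesP.
    case/orP => [/eqP->|/andP[nxr /boxesP[i xb]]].
      have lt1 : (t.+1 < n)%N by apply: leq_ltn_trans ltr (ltn_ord r).
      have [i zb] := col (Ordinal lt1) (ltnSn t) ltr.
      exists i; have <- : jump r t (Ordinal lt1) = t; last exact: box_jump.
      by apply/val_inj; rewrite /= jumpE /= ltnSn ltr.
    have [/andP[tx xr]|nx] := boolP (t < x <= r)%N; last first.
      exists i; have <- : jump r t x = x; last exact: box_jump.
      by rewrite /jump (negbTE nx).
    have ltxr : (x < r)%N by rewrite ltn_neqAle nxr.
    have lt1 : (x.+1 < n)%N by apply: leq_ltn_trans ltxr (ltn_ord r).
    have [i' zb] := col (Ordinal lt1) (ltnW tx) ltxr.
    exists i'; have <- : jump r t (Ordinal lt1) = x; last exact: box_jump.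
    by apply/val_inj; rewrite /= jumpE /= ltxr ltnS (ltnW tx).
  move=> [i xb]; have [xT' _] := elimT (box_ofP _ _) xb.
  have [z0 z0T _] := T'le _ _ xT'; have [z zb _] := box_of_exists z0T.
  rewrite (box_of_uniq xb (box_jump _ _ zb)) => {x xb xT' z0 z0T}.
  have [/andP[tz zr]|nz] := boolP (t < z <= r)%N; last first.
    have -> : jump r t z = z by rewrite /jump (negbTE nz).
    apply/orP; right; apply/andP; split; last by apply/boxesP; exists i.
    by apply: contra nz => /eqP->; rewrite ltr leqnn.
  have [//|ne] := eqVneq (jump r t z) t; apply/orP; right.
  have ez : jump r t z = z.-1 :> nat by rewrite jumpE tz zr.
  have ltj : (t < jump r t z)%N.
    rewrite ltn_neqAle eq_sym [X in ~~ X && _](_ : _ = (jump r t z == t)) // ne ez.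
    by rewrite -ltnS prednK //; apply: leq_ltn_trans tz.
  have ltjr : (jump r t z < r)%N by rewrite ez prednK //; apply: leq_ltn_trans tz.
  rewrite -val_eqE ltn_eqF //=; apply/boxesP; exact: col (ltnW ltjr).
rewrite in_setU.
have -> : ((x, w k0) \in [set (x, w k) | x in K]) = (x \in K) && (k0 == k).
  apply/imsetP/andP => [[z zK [-> /perm_inj ->]]|[xK /eqP->]]; first by rewrite zK eqxx.
  by exists x.
have [->|nk] := eqVneq k0 k; last first.
  rewrite andbF /=.
  by apply/ghostsP/ghostsP => -[i xT]; exists i; rewrite ?T'E // in xT *.
rewrite andbT; apply/idP/ghostsP.
  case/orP => [xK|/ghostsP[i /setDP[xT nxb]]].
    exists i0; rewrite in_setD; apply/andP; split; last by apply/T'P; right.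
    rewrite (memK _ xK); apply/negP => /box_ofP[_ /(_ (jump r t r))].
    by rewrite leqNgt jumpr // => /(_ _)/negP; case; [apply/T'P; left; exists r |].
  have nx : ~~ (t < x <= r)%N by apply: contra nxb; apply: moved_box.
  have ex : jump r t x = x by rewrite /jump (negbTE nx).
  exists i; rewrite in_setD; apply/andP; split; last by apply/T'P; left; exists x.
  apply: contra nxb => xb; have [z zb lez] := box_of_exists xT.
  have exz := box_of_uniq xb (box_jump _ _ zb).
  have -> : x = z; last exact: zb.
  by apply/val_inj/eqP; rewrite eqn_leq lez {1}exz jump_le.
case=> i /setDP[/T'P[[z zT ->]|[-> ->] //] nb]; apply/orP; right.
have nzb : z \notin box_of (T (i, k)) by apply: contra nb; apply: box_jump.
have nz : ~~ (t < z <= r)%N by apply: contra nzb; apply: moved_box.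
have -> : jump r t z = z by rewrite /jump (negbTE nz).
by apply/ghostsP; exists i; rewrite in_setD nzb.
Qed.

Lemma GKKoh_fillings : avoids1432 w -> GKKoh w = [set diagram T | T in fillings w].
Proof.
move=> av; apply/eqP; rewrite eqEsubset; apply/andP; split; apply/subsetP => E; last first.
  by case/imsetP => T fT ->; apply: (subsetP (KKoh_sub_GKKoh w)); apply: diagram_KKoh.
rewrite inE => /connectP[p]; rewrite -diagram_initial.
elim: p (initial_filling w) (initial_in_fillings w) => [|F p IH] T fT /=.
  by move=> _ ->; apply: imset_f.
case/andP => mv.
have [T' fT' ->] : exists2 T', T' \in fillings w & F = diagram T'.
  case/or4P: mv => mv; [apply: box_closed av fT _|apply: box_closed av fT _
    |apply: ghost_closed fT _|apply: ghost_closed fT _]; by rewrite /box_move mv ?orbT.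
exact: IH.
Qed.

Lemma KKoh_fillings : avoids1432 w -> KKoh w = [set diagram T | T in fillings w].
Proof.
move=> av; apply/eqP; rewrite eqEsubset -{1}GKKoh_fillings // KKoh_sub_GKKoh /=.
by apply/subsetP => E /imsetP[T fT ->]; apply: diagram_KKoh.
Qed.

End KohnertClosure.

(** * Counting diagrams and pipe dreams *)

Section Assembly.
Variable n : nat.
Implicit Types (w : 'S_n) (alpha : 'X_{1..n}).
Local Notation poly := {mpoly int[n]}.
Local Notation cell := ('I_n * 'I_n)%type.

Lemma filling_weight_neg w T : T \in fillings w ->
  filling_weight (@neg_var n) T
  = (-1) ^+ mdeg (grave_weight (diagram w T)) * 'X_[grave_weight (diagram w T)].
Proof.
move=> fT; rewrite diagram_weight // mdeg_diagram // /filling_weight -prodrXr -big_split /=; apply: eq_bigr => p _.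
transitivity (\prod_(x in T p) (-1 * 'X_x : poly)).
  by apply: eq_bigr => x _; rewrite mulN1r.
by rewrite big_split prodr_const.
Qed.

Lemma pd_weight_prod (P : {set cell}) :
  'X_[pd_weight P] = \prod_(c in P) 'X_c.1 :> poly.
Proof.
rewrite mpolyXE_id; transitivity (\prod_(i < n) \prod_(j | (i, j) \in P) 'X_i : poly).
  apply: eq_bigr => i _; rewrite mnmE prodr_const; congr (_ ^+ _).
  by apply: eq_card => j; rewrite inE.
by rewrite pair_big_dep /=; apply: eq_big => [[i j]|].
Qed.

Lemma mcoeff_sum_monomials (I : finType) (A : {set I}) (f : I -> 'X_{1..n}) alpha :
  (\sum_(a in A) 'X_[f a] : poly)@_alpha = #|[set a in A | f a == alpha]|%:R.
Proof.
rewrite raddf_sum /= -sum1_card natr_sum big_mkcond [RHS]big_mkcond /=.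
apply: eq_bigr => a _; rewrite inE; case: (a \in A) => //=.
by rewrite mcoeffX; case: eqP.
Qed.

Lemma signz_sub (a b : nat) : (-1 : int) ^ (a%:Z - b%:Z) = (-1) ^+ (b + a).
Proof.
rewrite exprzDr ?unitrN1 // -invr_expz -!exprnP invr_sign exprD mulrC.
by [].
Qed.

Lemma longest_avoids1432 : avoids1432 (longest_perm n).
Proof.
case=> [i [j [k [l [[ij jk kl] [il _ _]]]]]].
by move: il; rewrite !permE /=; have := ltn_ord l; lia.
Qed.

(** All pairs are inversions, so strict increase from the top row makes each entry at least its row,
    hence equal to it. *)
Lemma longest_fillings T : T \in fillings (longest_perm n) ->
  T = initial_filling (longest_perm n).
Proof.
set w0 := longest_perm n => /fillingsP v.
have inv0 i k : inversion w0 i k = (i < k)%N.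
  by rewrite /inversion !permE /=; have := ltn_ord k; lia.
have full m (p k x : 'I_n) : p = m :> nat -> x \in T (p, k) -> (p <= x)%N.
  elim: m p x => [|m IHm] p x ep xT; first by rewrite ep.
  have ltm : (m < n)%N by apply: ltn_trans (ltn_ord p); rewrite ep.
  have ltmp : (Ordinal ltm < p)%N by rewrite /= ep.
  have ltpk : (p < k)%N by rewrite -inv0; apply: valid_mem_inv v xT.
  have [|y yT] := @valid_mem _ _ _ _ _ (Ordinal ltm) k v.
    by rewrite inv0; apply: ltn_trans ltpk.
  rewrite ep; apply: leq_ltn_trans (valid_col v ltmp yT xT).
  exact: (IHm (Ordinal ltm)).
have eqT i k x : x \in T (i, k) -> x = i.
  move=> xT; apply/val_inj/eqP; rewrite eqn_leq (valid_le v xT).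
  exact: full xT.
apply/ffunP => -[i k]; rewrite ffunE /=; case: ifPn => inv.
  have [x xT] := valid_mem v inv; apply/setP => z; rewrite in_set1.
  apply/idP/eqP => [/eqT //|->]; by have := xT; rewrite {1}(eqT _ _ _ xT).
by apply/eqP; rewrite -[_ == _]negbK (valid_inv v).
Qed.

Lemma hecke_sum_longest : hecke_sum (@neg_var n) (longest_perm n)
  = (-1) ^+ coxeter_length (longest_perm n) * staircase_monomial n.
Proof.
set w0 := longest_perm n.
rewrite -filling_sum_hecke; last exact: longest_avoids1432.
rewrite ffunE (big_pred1 (initial_filling w0)) => [|T]; last first.
  have e : valid 0 n.-1 w0 T = (T \in fillings w0) by rewrite inE.
  rewrite /= e; apply/idP/eqP => [/longest_fillings //|->].
  exact: initial_in_fillings.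
have f0 := initial_in_fillings w0.
rewrite (filling_weight_neg f0) mdeg_diagram //; congr ((-1) ^+ _ * _).
  rewrite /coxeter_length -sum1_card big_mkcond [RHS]big_mkcond /=.
  apply: eq_bigr => p _; rewrite ffunE inE /inversion.
  by case: ifP; rewrite ?cards1 ?cards0.
congr 'X_[_]; apply/mnmP => i; rewrite grave_weight_diagram // mnmE.
have -> : #|[pred p | i \in initial_filling w0 p]| = #|(pair i) @: [set k : 'I_n | (i < k)%N]|.
  apply: eq_card => -[i' k]; rewrite inE ffunE /=.
  have -> : inversion w0 i' k = (i' < k)%N.
    by rewrite /inversion !permE /=; have := ltn_ord k; lia.
  apply/idP/imsetP => [|[k']]; last by rewrite inE => lt [-> ->]; rewrite lt inE.
  by case: ifP => lt; rewrite inE // => /eqP->; exists k; rewrite ?inE.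
rewrite card_imset; last by move=> k k' [].
rewrite -sum1_card (eq_bigl (fun k : 'I_n => i < k)%N) => [|k]; last by rewrite inE.
by rewrite -(big_geq_mkord i.+1 n predT (fun=> 1%N)) sum_nat_const_nat muln1.
Qed.

End Assembly.

Theorem corollary4p29 (n : nat) (w : 'S_n) (hw : avoids1432 w) :
  [/\ grothendieck w =
        \sum_(E in KKoh w)
          (-1 : int) ^ ((mdeg (grave_weight E))%:Z - (coxeter_length w)%:Z)
            *: 'X_[grave_weight E],
      (forall alpha : 'X_{1..n},
         #|KKoh_of_weight w alpha| = #|PD_of_weight w alpha|)
    & (forall alpha : 'X_{1..n},
         #|GKKoh_of_weight w alpha| = #|PD_of_weight w alpha|)].
Proof.
have injD : {in fillings w &, injective (diagram w)} by apply: diagram_inj.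
have sumT (R : comNzRingType) (y : 'I_n -> R) :
    \sum_(T in fillings w) filling_weight y T = hecke_sum y w.
  by rewrite -filling_sum_hecke // ffunE; apply: eq_bigl => T; rewrite inE.
have countK alpha : #|KKoh_of_weight w alpha| = #|PD_of_weight w alpha|.
  (* With y_i = x_i the coefficients of [hecke_sum] count both families; y_i = -x_i gives the
     Grothendieck formula. *)
  have : \sum_(T in fillings w) 'X_[grave_weight (diagram w T)]
      = \sum_(P in PD w) 'X_[pd_weight P] :> {mpoly int[n]}.
    under [LHS]eq_bigr => T fT do rewrite (diagram_weight fT).
    under [RHS]eq_bigr => P _ do rewrite pd_weight_prod.
    by rewrite sumT -(PD_sum (fun i => 'X_i : {mpoly int[n]})).
  move=> /(congr1 (mcoeff alpha)); rewrite !mcoeff_sum_monomials => /eqP.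
  rewrite Num.Theory.eqr_nat => /eqP <-.
  have -> : KKoh_of_weight w alpha
      = diagram w @: [set T in fillings w | grave_weight (diagram w T) == alpha].
    apply/setP => E; rewrite inE KKoh_fillings //; apply/andP/imsetP.
      by case=> /imsetP[T fT ->] wT; exists T; rewrite // inE fT.
    by case=> T; rewrite inE => /andP[fT wT] ->; rewrite imset_f.
  rewrite card_in_imset // => T T'; rewrite !inE => /andP[fT _] /andP[fT' _].
  by apply: injD; rewrite inE.
split=> //; last first.
  by move=> alpha; rewrite -countK /GKKoh_of_weight GKKoh_fillings // -KKoh_fillings.
rewrite grothendieck_hecke; last exact: hecke_sum_longest.
rewrite -sumT KKoh_fillings // big_imset //= mulr_sumr; apply: eq_bigr => T fT.
rewrite (filling_weight_neg fT) signz_sub mulrA -exprD.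
by rewrite -mul_mpolyC rmorphXn /= rmorphN1.
Qed.
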